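(* Let $\lambda,\mu$ be partitions with at most $\ell$ parts, with $\ell(\lambda)\le\ell$. Suppose $\pi_jx_i\in(0,1)$, $\alpha_kx_i>-1$ and $\alpha_k+\pi_j\ge0$ for all $i,j,k$. Set $\beta_j=\pi_{j+1}$. Let $\mathsf{P}_{\mathcal{C},n}(\lambda\mid\mu)$ be the $n$-step transition probability of the inhomogeneous geometric blocking particle system. Then $\mathsf{P}_{\mathcal{C},n}(\lambda\mid\mu)=\prod_{i=1}^n(1-\pi_1x_i)\,(\vec{\boldsymbol{\alpha}}+\boldsymbol{\pi})^{\lambda/\mu}\,G_{\lambda/\!/\mu}(\mathbf{x}_n;\boldsymbol{\alpha},\boldsymbol{\beta})$.
   Context: Particle system: $\ell$ particles labelled $1,\dots,\ell$ on $\mathbb{Z}_{\ge0}$ (sites may be shared); $G(j,i)$ is the position of particle $j$ after time step $i$, $G(1,i)\ge\dots\ge G(\ell,i)\ge0$, so configurations are partitions with at most $\ell$ parts. Parameters: $x_1,x_2,\dots$; $\pi_1,\dots,\pi_\ell$ with $\pi_j=0$ for $j>\ell$; position parameters $\alpha_0=0,\alpha_1,\alpha_2,\dots$. At time step $i$, particles are updated in order $\ell,\ell-1,\dots,1$ by $G(j,i)=\min(G(j,i-1)+w_{ji},G(j-1,i-1))$ with $G(0,i)=\infty$, where, given $G(j,i-1)=m$, $w_{ji}$ has the inhomogeneous geometric law $\mathsf{P}(w_{ji}=m'\mid G(j,i-1)=m)=\frac{1-\pi_jx_i}{1+\alpha_{m+m'}x_i}\prod_{k=m}^{m+m'-1}\frac{(\alpha_k+\pi_j)x_i}{1+\alpha_kx_i}$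 for $m'\ge0$ (independently of everything else given the current positions). $\mathsf{P}_{\mathcal{C},n}(\lambda\mid\mu)=\mathsf{P}(G(\cdot,n)=\lambda\mid G(\cdot,0)=\mu)$. Notation: $(\vec{\boldsymbol{\alpha}}+\boldsymbol{\pi})^{\lambda/\mu}=\prod_{b}(\alpha_{c(b)-1}+\pi_{r(b)})$ over boxes $b$ of $\lambda/\mu$ (zero if $\mu\not\subseteq\lambda$), $r(b),c(b)$ being the row and column of $b$; $\mathbf{x}_n$ means setting $x_{n+1}=x_{n+2}=\dots=0$. Canonical Grothendieck functions: a hook tableau is a filling of a hook shape $(a,1^m)$ (arm $a-1$, leg $m$) with positive integers, row weakly increasing, column strictly increasing. A hook-valued tableau of shape $\lambda/\nu$ assigns to each box $b$ a hook tableau $T(b)$ with $\max T(b)\le\min T(b')$ for $b'$ immediately right of $b$ and $\max T(b)<\min T(b'')$ for $b''$ immediately below $b$. $G_{\lambda/\nu}(\mathbf{x};\boldsymbol{\alpha},\boldsymbol{\beta})=\sum_T\prod_b(-\alpha_{c(b)})^{\mathrm{arm}(T(b))}(-\beta_{r(b)})^{\mathrm{leg}(T(b))}\prod_{e\in T(b)}x_e$. For $\mu\subseteq\lambda$, $G_{\lambda/\!/\mu}(\mathbf{x};\boldsymbol{\alpha},\boldsymbol{\beta})=\sum_\nu\prod_{b\in\mu/\nu}\bigl(-(\alpha_{c(b)}+\beta_{r(b)})\bigr)G_{\lambda/\nu}(\mathbf{x};\boldsymbol{\alpha},\boldsymbol{\beta})$, summed over all $\nu$ obtained from $\mu$ by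 removing a subset of its corners (boxes $(r,\mu_r)$ with $\mu_r>\mu_{r+1}$); $G_{\lambda/\!/\mu}:=0$ if $\mu\not\subseteq\lambda$. *)

(* Defs.v *)
From HB Require Import structures.
From mathcomp Require Import all_boot all_order all_algebra.
From mathcomp Require Import all_classical all_reals all_analysis.
(* The notations of mpoly clash with those of mathcomp-analysis. *)
From mathcomp Require Import -(notations) mpoly.

Set Implicit Arguments.
Unset Strict Implicit.
Unset Printing Implicit Defensive.

Import Order.TTheory GRing.Theory Num.Theory.

Local Open Scope classical_set_scope.
Local Open Scope ring_scope.

(** * Partitions and boxes; rows and columns are numbered from 1 *)

Definition is_partition (s : seq nat) : bool :=
  sorted geq s && (0%N \notin s).

Definition part (s : seq nat) (r : nat) : nat := nth 0%N s r.-1.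

Definition subshape (mu lam : seq nat) : Prop :=
  forall r, (1 <= r)%N -> (part mu r <= part lam r)%N.

(* A box is the pair (row, column). *)
Definition boxes (lam nu : seq nat) : seq (nat * nat) :=
  [seq (r, c) | r <- iota 1 (size lam),
                c <- iota (part nu r).+1 (part lam r - part nu r)].

Definition alpha_pi_power (R : realType) (alpha pi_ : nat -> R)
    (lam mu : seq nat) : R :=
  if `[< subshape mu lam >]
  then \prod_(b <- boxes lam mu) (alpha b.2.-1 + pi_ b.1) else 0.

(** * Hook-valued tableaux *)

(* The triple (corner entry, entries of the arm from left to right, entries of
   the leg from top to bottom), corner excluded from the arm and the leg. *)
Notation hook := (nat * seq nat * seq nat)%type.

Definition corner (h : hook) : nat := h.1.1.
Definition arm (h : hook) : seq nat := h.1.2.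
Definition leg (h : hook) : seq nat := h.2.

Definition hook_entries (h : hook) : seq nat := corner h :: arm h ++ leg h.

Definition is_hook_tableau (h : hook) : bool :=
  [&& all (leq 1) (hook_entries h),
      sorted leq (corner h :: arm h) & sorted ltn (corner h :: leg h)].

Definition hook_max (h : hook) : nat := (\max_(e <- hook_entries h) e)%N.
Definition hook_min (h : hook) : nat :=
  \big[minn/corner h]_(e <- hook_entries h) e.

Notation skew_box lam nu := (seq_sub (boxes lam nu)).
Notation hook_filling lam nu := {ffun skew_box lam nu -> hook}.

Definition box_row (lam nu : seq nat) (b : skew_box lam nu) : nat :=
  (ssval b).1.
Definition box_col (lam nu : seq nat) (b : skew_box lam nu) : nat :=
  (ssval b).2.

Definition is_hook_valued_tableau (lam nu : seq nat)
    (T : hook_filling lam nu) : Prop :=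
  [/\ forall b, is_hook_tableau (T b),
      forall b b', box_row b' = box_row b -> box_col b' = (box_col b).+1 ->
        (hook_max (T b) <= hook_min (T b'))%N
    & forall b b', box_row b' = (box_row b).+1 -> box_col b' = box_col b ->
        (hook_max (T b) < hook_min (T b'))%N].

(* The product of x_e over all entries e of T is the monomial m in x_1, ..., x_n;
   the exponent of x_(i+1) in m is m i, for i : 'I_n. *)
Definition has_content (n : nat) (m : multinom n) (lam nu : seq nat)
    (T : hook_filling lam nu) : Prop :=
  (forall b e, e \in hook_entries (T b) -> (1 <= e <= n)%N) /\
  (forall i : 'I_n, (\sum_b count_mem i.+1 (hook_entries (T b)))%N = m i).

Definition tableau_weight (R : realType) (alpha beta : nat -> R)
    (lam nu : seq nat) (T : hook_filling lam nu) : R :=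
  \prod_b ((- alpha (box_col b)) ^+ size (arm (T b)) *
           (- beta (box_row b)) ^+ size (leg (T b))).

(** * Grothendieck functions as formal power series in x_1, ..., x_n *)

(* A formal power series is given by its coefficients. *)
Definition series_in (R : realType) (n : nat) : Type := multinom n -> R.

(* G_{lam/nu}(x_n; alpha, beta): setting x_(n+1) = x_(n+2) = ... = 0 keeps the
   tableaux with entries at most n.  Arms are unbounded, but only finitely many
   tableaux have a given content, so each coefficient is a finite sum. *)
Definition G_skew (R : realType) (n : nat) (alpha beta : nat -> R)
    (lam nu : seq nat) : series_in R n :=
  fun m => \sum_(T \in [set T : hook_filling lam nu |
                          is_hook_valued_tableau T /\ has_content m T])
             tableau_weight alpha beta T.

(* The index r : 'I_(size mu) stands for row r + 1. *)
Definition corner_rows (mu : seq nat) (S : {set 'I_(size mu)}) : bool :=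
  [forall r in S, (part mu r.+2 < part mu r.+1)%N].

Definition remove_corners (mu : seq nat) (S : {set 'I_(size mu)}) : seq nat :=
  [seq (part mu r.+1 - (r \in S))%N | r : 'I_(size mu)].

Definition G_dslash (R : realType) (n : nat) (alpha beta : nat -> R)
    (lam mu : seq nat) : series_in R n :=
  fun m => if `[< subshape mu lam >] then
    \sum_(S : {set 'I_(size mu)} | corner_rows S)
      (\prod_(b <- boxes mu (remove_corners S)) - (alpha b.2 + beta b.1)) *
      G_skew alpha beta lam (remove_corners S) m
  else 0.

(** * Value at a point of a rational formal power series *)

Definition truncation (R : realType) (n : nat) (F : series_in R n) (d : nat) :
    mpoly n R :=
  \sum_(m : bmultinom n d) F (bmnm m) *: mpolyX R (bmnm m).

(* B * F = A as formal power series: the coefficient of m in B * F only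
   involves the coefficients of F in degree at most mdeg m. *)
Definition series_quotient (R : realType) (n : nat) (F : series_in R n)
    (A B : mpoly n R) : Prop :=
  forall m : multinom n,
    mcoeff m (B * truncation F (mdeg m).+1) = mcoeff m A.

(* F is the expansion of the rational function A / B, which is defined at x with
   value y.  The value is unique (rational_value_unique); it extends the sum of
   the series at x to points where the series diverges, which is needed because
   the arms contribute geometric series in - alpha_k x_i, where alpha_k x_i is
   only assumed to be larger than -1. *)
Definition rational_value (R : realType) (n : nat) (F : series_in R n)
    (x : 'I_n -> R) (y : R) : Prop :=
  exists A B : mpoly n R,
    [/\ series_quotient F A B, meval x B != 0 & y = meval x A / meval x B].

Lemma mcoeffM_congr (R : realType) (n d : nat) (p q r : mpoly n R) :
  (forall m, (mdeg m < d)%N -> mcoeff m p = mcoeff m q) ->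
  forall m, (mdeg m < d)%N -> mcoeff m (r * p) = mcoeff m (r * q).
Proof.
move=> pq m md; rewrite !mcoeffM.
by apply: eq_bigr => k _; rewrite pq// (leq_trans (bmdeg k.2)).
Qed.

Lemma mcoeff_truncation (R : realType) (n : nat) (F : series_in R n) d m :
  (mdeg m < d)%N -> mcoeff m (truncation F d) = F m.
Proof.
move=> md; rewrite /truncation raddf_sum/= (bigD1 (BMultinom md))//=.
rewrite mcoeffZ mcoeffX eqxx mulr1 big1 ?addr0// => k kN.
rewrite mcoeffZ mcoeffX; case: eqP => [km|]; last by rewrite mulr0.
by case/eqP: kN; apply/val_inj.
Qed.

Lemma rational_value_unique (R : realType) (n : nat) (F : series_in R n)
    (x : 'I_n -> R) (y y' : R) :
  rational_value F x y -> rational_value F x y' -> y = y'.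
Proof.
move=> [A [B [FAB Bx ->]]] [A' [B' [FAB' B'x ->]]].
have low d A1 B1 : series_quotient F A1 B1 ->
    forall m, (mdeg m < d)%N ->
    mcoeff m A1 = mcoeff m (B1 * truncation F d).
  move=> FA m md; rewrite -FA; apply: (@mcoeffM_congr _ _ (mdeg m).+1) => //.
  by move=> k km; rewrite !mcoeff_truncation// (leq_trans km).
have E : B' * A = B * A'.
  apply/mpolyP => m; have md := ltnSn (mdeg m).
  rewrite (@mcoeffM_congr _ _ (mdeg m).+1 _ _ _ (low _ _ _ FAB))//.
  rewrite (@mcoeffM_congr _ _ (mdeg m).+1 _ _ _ (low _ _ _ FAB'))//.
  by rewrite !mulrA [B' * B]mulrC.
have := congr1 (meval x) E; rewrite !mevalM => Ex.
apply/eqP; rewrite eqr_div// mulrC Ex mulrC; exact/eqP.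
Qed.

(** * The inhomogeneous geometric blocking particle system *)

(* P(w = m' | current position = m) for the parameters pj = pi_j, xi = x_i. *)
Definition jump_law (R : realType) (alpha : nat -> R) (pj xi : R)
    (m m' : nat) : R :=
  (1 - pj * xi) / (1 + alpha (m + m')%N * xi) *
  \prod_(m <= k < m + m') ((alpha k + pj) * xi / (1 + alpha k * xi)).

Definition cond_prob (d : measure_display) (T : measurableType d)
    (R : realType) (P : probability T R) (A B : set T) : R :=
  fine (P (A `&` B)) / fine (P B).

Section blocking.
Context (d : measure_display) (T : measurableType d) (R : realType).
Variables (P : probability T R) (ell : nat) (x pi_ alpha : nat -> R).
(* G j i: position of particle j after step i; w j i: its jump at step i. *)
Variables (G w : nat -> nat -> T -> nat).

Definition at_config (i : nat) (lam : seq nat) : set T :=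
  [set t | forall j, (1 <= j <= ell)%N -> G j i t = part lam j].

(* All positions up to time i are given by g and all jumps up to time i by v. *)
Definition history (i : nat) (g v : nat -> nat -> nat) : set T :=
  [set t | (forall j k, (1 <= j <= ell)%N -> (k <= i)%N -> G j k t = g j k) /\
           (forall j k, (1 <= j <= ell)%N -> (1 <= k <= i)%N ->
              w j k t = v j k)].

Record geometric_blocking_system : Prop := GeometricBlockingSystem {
  position_measurable : forall j i, (1 <= j <= ell)%N ->
    measurable_fun [set: T] (G j i) ;
  jump_measurable : forall j i, (1 <= j <= ell)%N -> (1 <= i)%N ->
    measurable_fun [set: T] (w j i) ;
  initially_ordered : forall j t, (1 <= j < ell)%N ->
    (G j.+1 0 t <= G j 0 t)%N ;
  update : forall j i t, (1 <= j <= ell)%N ->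
    G j i.+1 t =
      if j == 1%N then (G j i t + w j i.+1 t)%N
      else minn (G j i t + w j i.+1 t) (G j.-1 i t) ;
  (* Given the past, the jumps of step i + 1 are independent, with laws that
     depend on the current positions only. *)
  jump_distribution : forall i (g v : nat -> nat -> nat) (u : nat -> nat),
    (0 < P (history i g v))%E ->
    cond_prob P [set t | forall j, (1 <= j <= ell)%N -> w j i.+1 t = u j]
      (history i g v) =
    \prod_(1 <= j < ell.+1) jump_law alpha (pi_ j) (x i.+1) (g j i) (u j)
}.

Definition transition_prob (n : nat) (lam mu : seq nat) : R :=
  cond_prob P (at_config n lam) (at_config 0 mu).

End blocking.

(* Main.v *)
(* A hook-valued tableau is determined by its corner entries together with the
   multiplicities of each letter in the arms and legs.  For fixed corner entries
   these multiplicities are independent, so each skew function is a finite sum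
   over corner fillings of products of geometric series: a box of column c and
   row r gets x / (1 + alpha_c x) at its own corner letter and
   y = (1 - beta_r x) / (1 + alpha_c x) at each later letter that its right and
   lower neighbours allow.  A corner of mu that is removed with weight
   - (alpha_c + beta_r) contributes 1 + sum_v (y_v - 1) prod_(i > v) y_i, which
   telescopes to prod_i y_i; hence in G_(lam//mu) the boxes of mu behave like
   filled boxes, and splitting off the largest letter gives a recursion in the
   number of variables.  Up to the factor (1 - pi_1 x) and the powers of
   alpha + pi, its coefficients are the one-step transition probabilities, in
   which a blocked particle contributes the tail of its jump law; the recursion
   is thus the Chapman-Kolmogorov equation. *)
Require Import Defs.
From HB Require Import structures.
From mathcomp Require Import all_boot all_order all_algebra.
From mathcomp Require Import all_classical all_reals all_analysis.
From mathcomp Require Import -(notations) mpoly.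
From mathcomp Require Import zify ring lra.

Import Order.TTheory GRing.Theory Num.Theory.

Local Open Scope classical_set_scope.
Local Open Scope ring_scope.

(** * Hooks as multiplicities *)

(** The factors of a tableau sit at the column c of a box, those of a jump at the site c - 1, and a
    box in row r carries beta_r = pi_(r+1), the parameter of the next particle. So one letter of
    growth and one step of the particles do not agree row by row: the denominators are shifted by
    one site, and part of the factor of row r belongs to particle r + 1. Multiplied over all rows,
    the mismatch telescopes. At the bottom it leaves 1, because pi_(ell+1) = 0 and alpha_0 = 0; at
    the top it leaves 1 - pi_1 x_i, the factor of the first particle, which nothing blocks. The
    geometric series of the arms need not converge at x. They are summed as congruences of
    polynomials in low degree, and evaluated only after the denominators are cleared. On the
    probabilistic side, the partial sums of a jump law are 1 minus a product that is not assumed to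
    tend to 0. That no mass escapes to infinity is forced by the existence of the system, on each
    history of positive probability. *)

Definition spell {n : nat} (a : 'I_n -> nat) : seq nat :=
  sort leq (flatten [seq nseq (a i) i.+1 | i <- enum 'I_n]).

Lemma count_spell {n : nat} (a : 'I_n -> nat) (j : 'I_n) :
  count_mem j.+1 (spell a) = a j.
Proof.
rewrite (permP (permEl (perm_sort _ _))) count_flatten -map_comp sumnE big_map.
rewrite big_enum /= (bigD1 j) //= count_nseq /= eqxx mul1n big1 ?addn0 // => i ij.
by rewrite count_nseq /= eqSS; have /negbTE -> : (i : nat) != j by []; rewrite mul0n.
Qed.

Lemma mem_spell {n : nat} (a : 'I_n -> nat) (e : nat) :
  reflect (exists2 i : 'I_n, e = i.+1 & (0 < a i)%N) (e \in spell a).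
Proof.
rewrite mem_sort; apply: (iffP flattenP) => [[s /mapP[i _ ->]]|[i -> ai]].
  by rewrite mem_nseq => /andP[ai /eqP ->]; exists i.
exists (nseq (a i) i.+1); first by apply/mapP; exists i; rewrite ?mem_enum.
by rewrite mem_nseq ai /=.
Qed.

Lemma size_spell {n : nat} (a : 'I_n -> nat) :
  size (spell a) = (\sum_(i < n) a i)%N.
Proof.
rewrite size_sort size_flatten /shape -map_comp sumnE big_map big_enum /=.
by apply: eq_bigr => i _; rewrite size_nseq.
Qed.

Lemma spell_sorted {n : nat} (a : 'I_n -> nat) : sorted leq (spell a).
Proof. exact/sort_sorted/leq_total. Qed.

Lemma spell_count (n : nat) (s : seq nat) :
  sorted leq s -> (forall e, e \in s -> (1 <= e <= n)%N) ->
  spell (fun i : 'I_n => count_mem i.+1 s) = s.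
Proof.
move=> ss sn; apply: (sorted_eq leq_trans anti_leq) => //; first exact: spell_sorted.
apply/allP => e /=; have [[i ->]|en] := pselect (exists i : 'I_n, e = i.+1).
  by rewrite count_spell.
have nos t : (forall e, e \in t -> (1 <= e <= n)%N) -> count_mem e t = 0%N.
  move=> tn; apply/count_memPn; apply/negP => /tn /andP[e0 ele]; apply: en.
  have e1 : (e.-1 < n)%N by rewrite prednK.
  by exists (Ordinal e1); rewrite /= prednK.
rewrite !nos // => f /mem_spell[i -> _]; by rewrite /= ltn_ord.
Qed.

Lemma ltn_sorted_count (s : seq nat) (e : nat) :
  sorted ltn s -> count_mem e s = (e \in s).
Proof. by rewrite ltn_sorted_uniq_leq => /andP[us _]; rewrite count_uniq_mem. Qed.

Lemma spell_bool_sorted {n : nat} (l : 'I_n -> bool) :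
  sorted ltn (spell (fun i => l i)).
Proof.
rewrite ltn_sorted_uniq_leq spell_sorted andbT; apply: count_mem_uniq => e.
have [/mem_spell[i -> li]|/count_memPn //] := boolP (e \in _).
by rewrite count_spell; case: (l i) li.
Qed.

(** The index [i : 'I_n] stands for the letter [i.+1]. A leg is strictly increasing, so a boolean
    per letter describes it, whereas the arm needs multiplicities. *)
Definition spelled_hook {n : nat} (k : 'I_n) (f : 'I_n -> nat * bool) : hook :=
  (k.+1, spell (fun i => (f i).1), spell (fun i => (f i).2 : nat)).

Definition hook_support {n : nat} (k : 'I_n) (f : 'I_n -> nat * bool) (i : 'I_n) :=
  [|| i == k, (0 < (f i).1)%N | (f i).2].

Lemma mem_spelled_hook {n : nat} (k : 'I_n) (f : 'I_n -> nat * bool) (e : nat) :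
  reflect (exists2 i : 'I_n, e = i.+1 & hook_support k f i)
          (e \in hook_entries (spelled_hook k f)).
Proof.
rewrite /hook_entries inE mem_cat /corner /arm /leg /=.
apply: (iffP or3P) => [[/eqP ->|/mem_spell[i -> fi]|/mem_spell[i -> fi]]|].
- by exists k; rewrite // /hook_support eqxx.
- by exists i; rewrite // /hook_support fi orbT.
- by exists i; rewrite // /hook_support; case: (f i).2 fi; rewrite ?orbT.
case=> i -> /or3P[/eqP ->|fi|fi].
- by apply: Or31.
- by apply: Or32; apply/mem_spell; exists i.
- by apply: Or33; apply/mem_spell; exists i; rewrite ?fi.
Qed.

Lemma count_spelled_hook {n : nat} (k : 'I_n) (f : 'I_n -> nat * bool) (i : 'I_n) :
  count_mem i.+1 (hook_entries (spelled_hook k f)) =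
  ((i == k) + (f i).1 + (f i).2)%N.
Proof.
rewrite /hook_entries /corner /arm /leg /= count_cat !count_spell eqSS eq_sym addnA.
by [].
Qed.

Lemma spelled_hook_tableau {n : nat} (k : 'I_n) (f : 'I_n -> nat * bool) :
  is_hook_tableau (spelled_hook k f) =
  [forall i : 'I_n, [&& (0 < (f i).1)%N ==> (k <= i)%N & (f i).2 ==> (k < i)%N]].
Proof.
rewrite /is_hook_tableau.
have -> : all (leq 1) (hook_entries (spelled_hook k f)).
  by apply/allP => e /mem_spelled_hook[i ->].
rewrite /corner /arm /leg /=.
apply/andP/forallP => [[]|kf].
  rewrite path_sortedE; last exact: leq_trans.
  rewrite path_sortedE; last exact: ltn_trans.
  move=> /andP[/allP al _] /andP[/allP ll _] i; apply/andP; split; apply/implyP => fi.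
    by have /(_ i.+1) := al; apply; apply/mem_spell; exists i.
  by have /(_ i.+1) := ll; apply; apply/mem_spell; exists i; rewrite ?fi.
split.
  rewrite path_sortedE ?spell_sorted ?andbT; last exact: leq_trans.
  by apply/allP => e /mem_spell[i -> fi]; have /andP[/implyP/(_ fi)] := kf i.
rewrite path_sortedE ?spell_bool_sorted ?andbT; last exact: ltn_trans.
apply/allP => e /mem_spell[i ->]; have /andP[_ /implyP] := kf i.
by case: (f i).2 => // /(_ isT).
Qed.

Lemma hook_tableau_spelled {n : nat} (h : hook) (k : 'I_n) :
  is_hook_tableau h -> (forall e, e \in hook_entries h -> (1 <= e <= n)%N) ->
  corner h = k.+1 ->
  h = spelled_hook k (fun i => (count_mem i.+1 (arm h), i.+1 \in leg h)).
Proof.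
move=> /and3P[_ sa sl] hn hk; rewrite /spelled_hook /= -hk.
rewrite spell_count; first last.
- by move=> e he; apply: hn; rewrite inE mem_cat he orbT.
- exact: path_sorted sa.
have {}sl := path_sorted sl.
have -> : spell (fun i : 'I_n => (i.+1 \in leg h) : nat) = leg h.
  rewrite -[RHS](@spell_count n).
  - by congr spell; apply/funext => i; rewrite ltn_sorted_count.
  - by move: sl; rewrite ltn_sorted_uniq_leq => /andP[].
  - by move=> e he; apply: hn; rewrite inE mem_cat he !orbT.
by case: h {sa sl hn hk} => [[]].
Qed.

Lemma hook_max_le (h : hook) (e : nat) :
  (hook_max h <= e)%N = all (geq e) (hook_entries h).
Proof.
apply/idP/allP => [he f fh|he]; last by apply/bigmax_leqP_seq => f fh _; exact: he.
by apply: leq_trans he; rewrite /hook_max; exact: leq_bigmax_seq.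
Qed.

(** Because of this, the conditions between neighbouring hooks compare each letter of one hook with
    the corner entry of the other. Once the corners are fixed, they constrain every letter
    separately. *)
Lemma hook_min_corner (h : hook) : is_hook_tableau h -> hook_min h = corner h.
Proof.
move=> /and3P[_ sa sl]; rewrite /hook_min.
have hc e : e \in hook_entries h -> (corner h <= e)%N.
  rewrite inE mem_cat => /or3P[/eqP -> //||].
    by move: sa => /(order_path_min leq_trans)/allP; apply.
  by move: sl => /(order_path_min ltn_trans)/allP sl /sl /ltnW.
apply/eqP; rewrite eqn_leq; apply/andP; split.
  by rewrite /hook_entries big_cons geq_minl.
by rewrite big_seq; elim/big_ind: _ => // u v hu hv; rewrite leq_min hu.
Qed.

(** * Hook-valued tableaux as multiplicities *)

Section tableaux.
Context {lam nu : seq nat} {n d : nat}.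
Implicit Types (b : skew_box lam nu) (k : {ffun skew_box lam nu -> 'I_n}).
Implicit Types (f : {ffun skew_box lam nu * 'I_n -> 'I_d * bool}).

Definition right_of b b' :=
  (box_row b' == box_row b) && (box_col b' == (box_col b).+1).

Definition below b b' :=
  (box_row b' == (box_row b).+1) && (box_col b' == box_col b).

(* With corner entries k, the hook in b may contain the letter i. *)
Definition active k b (i : 'I_n) : bool :=
  [forall b', (right_of b b' ==> (i <= k b')%N) && (below b b' ==> (i < k b')%N)].

(** At the corner letter, absence is no way out, since the corner entry itself is present: if this
    letter is not active, no choice is admissible and the sum over choices is empty. *)
Definition letter_ok k (bi : skew_box lam nu * 'I_n) : pred ('I_d * bool) :=
  fun al => let absent := (al.1 == 0%N :> nat) && ~~ al.2 in
  if (bi.2 < k bi.1)%N then absent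
  else if bi.2 == k bi.1 then active k bi.1 bi.2 && ~~ al.2
  else active k bi.1 bi.2 || absent.

Definition multiplicities f b (i : 'I_n) : nat * bool :=
  ((f (b, i)).1 : nat, (f (b, i)).2).

Definition spelled_filling k f : hook_filling lam nu :=
  [ffun b => spelled_hook (k b) (multiplicities f b)].

(** Membership in a [family] means that, for given corners, the conditions on different pairs of a
    box and a letter are independent; this is what lets the sum over tableaux factor. *)
Lemma spelled_filling_tableau k f :
  is_hook_valued_tableau (spelled_filling k f) <-> f \in family (letter_ok k).
Proof.
split=> [[hT rT bT]|fk].
  apply/familyP => -[b i].
  have := hT b; rewrite ffunE spelled_hook_tableau => /forallP/(_ i).
  rewrite /multiplicities /= => /andP[/implyP k1 /implyP k2].
  have act : hook_support (k b) (multiplicities f b) i -> active k b i.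
    move=> si; have si' : i.+1 \in hook_entries (spelled_filling k f b).
      by rewrite ffunE; apply/mem_spelled_hook; exists i.
    apply/forallP => b'; apply/andP; split; apply/implyP => /andP[/eqP r /eqP c].
      have := rT b b' r c; rewrite hook_min_corner; last exact: hT.
      by rewrite hook_max_le => /allP/(_ _ si') /=; rewrite ffunE.
    have := bT b b' r c; rewrite hook_min_corner; last exact: hT.
    by rewrite [X in corner X]ffunE /corner /= ltnS hook_max_le => /allP/(_ _ si').
  rewrite ?inE -?topredE /= /letter_ok /=; case: ltnP => [ik|ki].
    move: k1 k2; case: (f (b, i)) => -[[|a] ha] [] //= k1 k2; exfalso.
    - by have := k2 isT; rewrite ltnNge (ltnW ik).
    - by have := k1 isT; rewrite leqNgt ik.
    - by have := k1 isT; rewrite leqNgt ik.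
  case: eqP => [ik|/eqP ik].
    rewrite act; last by rewrite /hook_support ik eqxx.
    by apply/negP => /k2; rewrite ik ltnn.
  case: (boolP (active k b i)) => //= na.
  apply/andP; split; apply: contraNT na => fi; apply: act; rewrite /hook_support.
    by rewrite /multiplicities /= lt0n fi orbT.
  by rewrite /multiplicities /= (negbNE fi) !orbT.
have hT b : is_hook_tableau (spelled_filling k f b).
  rewrite ffunE spelled_hook_tableau; apply/forallP => i.
  have /familyP/(_ (b, i)) := fk;
    rewrite ?inE -?topredE /= /letter_ok /multiplicities /=.
  case: ltnP => [ik /andP[/eqP -> /negbTE ->] //|ki].
  rewrite implybT /=; case: eqP => [->|/eqP ik _].
    by move=> /andP[_ /negbTE ->].
  by rewrite ltn_neqAle ki eq_sym ik implybT.
have sup b i : hook_support (k b) (multiplicities f b) i -> active k b i.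
  have /familyP/(_ (b, i)) := fk;
    rewrite ?inE -?topredE /= /letter_ok /hook_support /multiplicities /=.
  case: ltnP => [ik /andP[/eqP -> /negbTE ->]|ki].
    by rewrite ltnn !orbF => /eqP ik'; move: ik; rewrite ik' ltnn.
  case: eqP => [ik /andP[] //|/eqP ik /orP[//|/andP[/eqP -> /negbTE ->]]].
  by rewrite ltnn.
split=> // b b' r c; rewrite hook_min_corner // [X in corner X]ffunE /corner /=.
  rewrite hook_max_le; apply/allP => e; rewrite ffunE => /mem_spelled_hook[i -> /sup].
  move=> /forallP/(_ b') /andP[/implyP + _]; apply.
  by rewrite /right_of r c !eqxx.
rewrite ltnS hook_max_le; apply/allP => e.
rewrite ffunE => /mem_spelled_hook[i -> /sup].
move=> /forallP/(_ b') /andP[_ /implyP]; apply.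
by rewrite /below r c !eqxx.
Qed.

Lemma spelled_filling_content k f (m : multinom n) :
  has_content m (spelled_filling k f) <->
  (forall i : 'I_n, (\sum_b ((i == k b) + (f (b, i)).1 + (f (b, i)).2))%N = m i).
Proof.
have cnt (i : 'I_n) : (\sum_b count_mem i.+1 (hook_entries (spelled_filling k f b)))%N =
   (\sum_b ((i == k b) + (f (b, i)).1 + (f (b, i)).2))%N.
  by apply: eq_bigr => b _; rewrite ffunE count_spelled_hook.
split=> [[_ h] i|h]; first by rewrite -cnt h.
split=> [b e|i]; last by rewrite cnt.
by rewrite ffunE => /mem_spelled_hook[i -> _]; rewrite /= ltn_ord.
Qed.

Lemma spelled_filling_weight (R : realType) (alpha beta : nat -> R) k f :
  tableau_weight alpha beta (spelled_filling k f) =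
  \prod_(bi : skew_box lam nu * 'I_n)
    ((- alpha (box_col bi.1)) ^+ (f bi).1 * (- beta (box_row bi.1)) ^+ (f bi).2).
Proof.
rewrite /tableau_weight.
pose F b (i : 'I_n) := (- alpha (box_col b)) ^+ (f (b, i)).1 *
   (- beta (box_row b)) ^+ (f (b, i)).2.
rewrite [RHS](eq_bigr (fun bi => F bi.1 bi.2)); last by case.
rewrite -pair_bigA /=; apply: eq_bigr => b _.
rewrite ffunE /arm /leg /= !size_spell !expr_sum -big_split /=.
by [].
Qed.

Lemma spelled_filling_inj :
  injective (fun kf : {ffun skew_box lam nu -> 'I_n} *
    {ffun skew_box lam nu * 'I_n -> 'I_d * bool} => spelled_filling kf.1 kf.2).
Proof.
move=> [k f] [k' f'] /= /ffunP E; congr pair.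
  apply/ffunP => b; have := E b; rewrite !ffunE /spelled_hook => -[/eqP + _ _].
  by move=> /eqP kk; apply/val_inj.
apply/ffunP => -[b i]; have := E b; rewrite !ffunE /spelled_hook => -[_ a l].
have := congr1 (count_mem i.+1) a; have := congr1 (count_mem i.+1) l.
rewrite !count_spell /multiplicities /=.
case: (f (b, i)) => a1 l1; case: (f' (b, i)) => a2 l2 /= ll /val_inj ->.
by case: l1 l2 ll {a l} => [] [].
Qed.

(** A multiplicity is at most the degree of the content, so bounding the arms by d loses no tableau
    of content m. *)
Lemma tableau_spelled (T : hook_filling lam nu) (m : multinom n) :
  (mdeg m < d)%N -> is_hook_valued_tableau T -> has_content m T ->
  exists k f, T = spelled_filling k f.
Proof.
move=> md [hT _ _] [Tn Tm].
have kP b : ((corner (T b)).-1 < n)%N.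
  have /andP[] := Tn b (corner (T b)) (mem_head _ _).
  by case: (corner (T b)).
have aP b (i : 'I_n) : (count_mem i.+1 (arm (T b)) < d)%N.
  apply: leq_ltn_trans md; rewrite mdegE (bigD1 i) //= -Tm (bigD1 b) //=.
  by rewrite /hook_entries /= count_cat addnCA -!addnA leq_addr.
exists [ffun b => Ordinal (kP b)],
  [ffun bi => (Ordinal (aP bi.1 bi.2), bi.2.+1 \in leg (T bi.1))].
apply/ffunP => b; rewrite ffunE.
rewrite {1}(@hook_tableau_spelled n (T b) (Ordinal (kP b))) //.
- rewrite ffunE; congr spelled_hook; apply/funext => i.
  by rewrite /multiplicities ffunE.
- exact: Tn.
- by rewrite /=; have /andP[] := Tn b (corner (T b)) (mem_head _ _); case: corner.
Qed.

End tableaux.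

Definition letter_monomial {R : realType} {n d : nat} (alpha beta : nat -> R)
    {lam nu : seq nat} (k : {ffun skew_box lam nu -> 'I_n})
    (bi : skew_box lam nu * 'I_n) (al : 'I_d * bool) : mpoly n R :=
  ((- alpha (box_col bi.1)) ^+ al.1 * (- beta (box_row bi.1)) ^+ al.2) *:
  mpolyX R (mnm1 bi.2) ^+ ((bi.2 == k bi.1) + al.1 + al.2).

(** Bounded multiplicities turn the series into a polynomial that agrees with it in degrees below d.
    Distributing the product over its inner sums recovers one term per pair of a corner filling and
    a choice of multiplicities. *)
Lemma G_skew_coef {R : realType} {n : nat} (alpha beta : nat -> R) (lam nu : seq nat)
    (d : nat) (m : multinom n) : (mdeg m < d)%N ->
  G_skew alpha beta lam nu m =
  mcoeff m (\sum_(k : {ffun skew_box lam nu -> 'I_n})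
    \prod_(bi : skew_box lam nu * 'I_n)
      \sum_(al : 'I_d * bool | letter_ok k bi al) letter_monomial alpha beta k bi al).
Proof.
move=> md.
pose Q (kf : {ffun skew_box lam nu -> 'I_n} *
    {ffun skew_box lam nu * 'I_n -> 'I_d * bool}) :=
  (kf.2 \in family (letter_ok kf.1)) && [forall i : 'I_n,
    (\sum_b ((i == kf.1 b) + (kf.2 (b, i)).1 + (kf.2 (b, i)).2))%N == m i].
have -> : G_skew alpha beta lam nu m =
    \sum_(kf | Q kf) tableau_weight alpha beta (spelled_filling kf.1 kf.2).
  pose s := [seq spelled_filling kf.1 kf.2 | kf <- enum Q].
  rewrite /G_skew (fsbigE s).
  - rewrite -big_filter (_ : seq.filter _ _ = s).
      by rewrite big_map big_enum.
    apply/all_filterP/allP => _ /mapP[kf + ->].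
    rewrite mem_enum => /andP[kfT /forallP kfm]; rewrite inE; split.
      exact/spelled_filling_tableau.
    by apply/spelled_filling_content => i; apply/eqP.
  - by rewrite map_inj_uniq ?enum_uniq; last exact: spelled_filling_inj.
  - move=> _ /= /mapP[kf + ->]; rewrite mem_enum => /andP[kfT /forallP kfm]; split.
      exact/spelled_filling_tableau.
    by apply/spelled_filling_content => i; apply/eqP.
  - move=> T [hT cT] /negP[]; have [k [f Tkf]] := tableau_spelled T m md hT cT.
    apply/mapP; exists (k, f) => //; rewrite mem_enum; apply/andP; split.
      by apply/spelled_filling_tableau; rewrite -Tkf.
    by move: cT; rewrite Tkf => /spelled_filling_content cT; apply/forallP => i;
      rewrite /= cT.
rewrite raddf_sum /=.
under [RHS]eq_bigr do rewrite bigA_distr_big_dep raddf_sum.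
rewrite pair_big_dep /= big_mkcond [RHS]big_mkcond; apply: eq_bigr => -[k f] _ /=.
rewrite /Q /=; case: (_ \in _) => //=.
rewrite /letter_monomial scaler_prod mcoeffZ mprodXnE mcoeffX spelled_filling_weight.
set M := (X in (X == m)%:R).
have Mi (i : 'I_n) : M i = (\sum_b ((i == k b) + (f (b, i)).1 + (f (b, i)).2))%N.
  rewrite mnm_sumE.
  under eq_bigr do rewrite mulmnE mnmE.
  pose F b (j : 'I_n) :=
    ((j == i) * ((j == k b) + (f (b, j)).1 + (f (b, j)).2))%N.
  rewrite [LHS](eq_bigr (fun bi => F bi.1 bi.2)); last by case.
  rewrite -pair_bigA.
  apply: eq_bigr => b _ /=; rewrite (bigD1 i) //= /F eqxx mul1n big1 ?addn0 // => j ji.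
  by rewrite (negbTE ji).
have -> : (M == m) = [forall i : 'I_n,
    (\sum_b ((i == k b) + (f (b, i)).1 + (f (b, i)).2))%N == m i].
  apply/eqP/forallP => [<- i|E]; first by rewrite Mi.
  by apply/mnmP => i; rewrite Mi; apply/eqP.
by case: ifP => _; rewrite ?mulr1 ?mulr0.
Qed.

(** * Rational power series *)

(** Congruence modulo the ideal spanned by the monomials of degree at least d. *)
Definition low_eq {R : realType} {n : nat} (d : nat) (p q : mpoly n R) : Prop :=
  forall m, (mdeg m < d)%N -> mcoeff m p = mcoeff m q.

Section low_degree.
Context {R : realType} {n : nat} (d : nat).
Implicit Types p q r : mpoly n R.

Lemma low_eqM p p' q q' :
  low_eq d p p' -> low_eq d q q' -> low_eq d (p * q) (p' * q').
Proof.
move=> pp qq m md; rewrite (mcoeffM_congr _ qq md) mulrC.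
by rewrite (mcoeffM_congr _ pp md) mulrC.
Qed.

Lemma low_eqD p p' q q' :
  low_eq d p p' -> low_eq d q q' -> low_eq d (p + q) (p' + q').
Proof. by move=> pp qq m md; rewrite !mcoeffD pp ?qq. Qed.

Lemma low_eq_sum (I : finType) (F F' : I -> mpoly n R) :
  (forall i, low_eq d (F i) (F' i)) -> low_eq d (\sum_i F i) (\sum_i F' i).
Proof. by move=> FF; elim/big_ind2: _ => // p p' q q'; exact: low_eqD. Qed.

Lemma low_eq_prod (I : finType) (F F' : I -> mpoly n R) :
  (forall i, low_eq d (F i) (F' i)) -> low_eq d (\prod_i F i) (\prod_i F' i).
Proof. by move=> FF; elim/big_ind2: _ => // p p' q q'; exact: low_eqM. Qed.

Lemma low_eq_Xn (c : R) (i : 'I_n) : low_eq d ((c *: mpolyX R (mnm1 i)) ^+ d) 0.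
Proof.
move=> m md; rewrite exprZn mcoeffZ mcoeffXn mcoeff0; case: eqP => [im|];
  last by rewrite mulr0.
by move: md; rewrite -im mdegMn mdeg1 mul1n ltnn.
Qed.

(** The product is 1 - (-c X)^d, and the last term has degree d. *)
Lemma low_eq_geometric (c : R) (i : 'I_n) :
  let X := mpolyX R (mnm1 i) in
  low_eq d ((1 + c *: X) * \sum_(a < d) (- c *: X) ^+ a) 1.
Proof.
move=> X; have -> : (1 + c *: X) * \sum_(a < d) (- c *: X) ^+ a = 1 - (- c *: X) ^+ d.
  by rewrite -opprB subrX1 -mulNr opprB scaleNr opprK.
by move=> m md; rewrite mcoeffB (low_eq_Xn (- c) i m md) mcoeff0 subr0.
Qed.

End low_degree.

Lemma rational_value_linear {R : realType} {n : nat} (x : 'I_n -> R) (c : R)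
    (F F' : series_in R n) (y y' : R) :
  rational_value F x y -> rational_value F' x y' ->
  rational_value ((fun m => c * F m + F' m) : series_in R n) x (c * y + y').
Proof.
move=> [A [B [FAB Bx ->]]] [A' [B' [FAB' B'x ->]]].
exists (c *: (B' * A) + B * A'), (B' * B); split.
- move=> m; have md := ltnSn (mdeg m).
  have low (A1 B1 : mpoly n R) (F1 : series_in R n) : series_quotient F1 A1 B1 ->
      low_eq (mdeg m).+1 (B1 * truncation F1 (mdeg m).+1) A1.
    move=> FA m' m'd; rewrite -FA; apply: (@mcoeffM_congr _ _ (mdeg m').+1) => //.
    by move=> k km; rewrite !mcoeff_truncation// (leq_trans km).
  set t := truncation _ _; have -> : t = c *: truncation F (mdeg m).+1 +
      truncation F' (mdeg m).+1.
    rewrite /t /truncation scaler_sumr -big_split /=; apply: eq_bigr => k _.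
    by rewrite scalerDl scalerA.
  rewrite mulrDr -scalerAr !mcoeffD !mcoeffZ; congr (_ * _ + _).
    by rewrite -mulrA (mcoeffM_congr _ (low _ _ _ FAB) md).
  by rewrite [B' * B]mulrC -mulrA (mcoeffM_congr _ (low _ _ _ FAB') md).
- by rewrite mevalM mulf_neq0.
- by rewrite mevalD mevalZ !mevalM; field; apply/andP.
Qed.

Lemma rational_value0 {R : realType} {n : nat} (x : 'I_n -> R) :
  rational_value ((fun=> 0) : series_in R n) x 0.
Proof.
exists 0, 1; split; rewrite ?meval1 ?oner_neq0 ?meval0 ?mul0r // => m.
by rewrite mul1r mcoeff0 mcoeff_truncation.
Qed.

Lemma rational_value_sum {R : realType} {n : nat} (x : 'I_n -> R) (I : finType)
    (Q : pred I) (c : I -> R) (F : I -> series_in R n) (y : I -> R) :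
  (forall i, Q i -> rational_value (F i) x (y i)) ->
  rational_value ((fun m => \sum_(i | Q i) c i * F i m) : series_in R n) x
    (\sum_(i | Q i) c i * y i).
Proof.
move=> Fy.
have -> : (fun m => \sum_(i | Q i) c i * F i m) =
    \big[(fun f g : series_in R n => fun m => f m + g m)/(fun=> 0)]_(i | Q i)
      (fun m => c i * F i m).
  apply/funext => m; elim/big_rec2: _ => // i f y' Qi ->; by [].
elim/big_rec2: _ => [|i y' f Qi fy]; first exact: rational_value0.
exact: rational_value_linear (Fy _ Qi) fy.
Qed.

(** * Rational expression of the skew functions *)

Section skew_value.
Context {R : realType} {n : nat} (alpha beta : nat -> R) {lam nu : seq nat}.
Implicit Types (k : {ffun skew_box lam nu -> 'I_n}).

Definition letter_denom (bi : skew_box lam nu * 'I_n) : mpoly n R :=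
  1 + alpha (box_col bi.1) *: mpolyX R (mnm1 bi.2).

(** All corner fillings share the denominator [\prod_bi letter_denom bi]; a letter that contributes
    1 therefore has [letter_denom bi] as its numerator. *)
Definition letter_num k (bi : skew_box lam nu * 'I_n) : mpoly n R :=
  if (bi.2 < k bi.1)%N then letter_denom bi
  else if bi.2 == k bi.1 then (active k bi.1 bi.2)%:R *: mpolyX R (mnm1 bi.2)
  else if active k bi.1 bi.2 then 1 - beta (box_row bi.1) *: mpolyX R (mnm1 bi.2)
  else letter_denom bi.

Definition letter_value (x : 'I_n -> R) k (b : skew_box lam nu) (i : 'I_n) : R :=
  if (i < k b)%N then 1
  else if i == k b then (active k b i)%:R * (x i / (1 + alpha (box_col b) * x i))
  else if active k b i
       then (1 - beta (box_row b) * x i) / (1 + alpha (box_col b) * x i)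
  else 1.

Lemma letter_sum_low (d : nat) k (bi : skew_box lam nu * 'I_n) :
  low_eq d.+1
    (letter_denom bi * \sum_(al : 'I_d.+1 * bool | letter_ok k bi al)
       letter_monomial alpha beta k bi al)
    (letter_num k bi).
Proof.
case: bi => b i; set X := mpolyX R (mnm1 i).
set L := \sum_(al | _) _; rewrite /letter_num /=.
have absent : i != k b -> \sum_(al : 'I_d.+1 * bool | (al.1 == 0%N :> nat) && ~~ al.2)
    letter_monomial alpha beta k (b, i) al = 1.
  move=> /negbTE ik; rewrite (big_pred1 (ord0, false)) /letter_monomial /= ?ik.
    by rewrite !expr0 mulr1 scale1r.
  by move=> [a []] /=; rewrite ?andbF ?andbT xpair_eqE ?andbF ?andbT.
have geo := low_eq_geometric d.+1 (alpha (box_col b)) i.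
case: ifP => [ik|nik].
  have -> : L = 1.
    rewrite -absent; last by apply/negP => /eqP ik'; move: ik; rewrite ik' ltnn.
    by apply: eq_bigl => al; rewrite /letter_ok /= ik.
  by rewrite mulr1.
case: ifP => [ik|nik2].
  case: (boolP (active k b i)) => act; last first.
    rewrite /L big_pred0 ?mulr0 ?scale0r // => al.
    by rewrite /letter_ok /= nik ik (negbTE act).
  have -> : L = \sum_(a < d.+1) (- alpha (box_col b) *: X) ^+ a * X.
    rewrite /L (eq_bigl (fun al => xpredT al.1 && ~~ al.2)); last first.
      by move=> al; rewrite /letter_ok /= nik ik act.
    rewrite -(pair_big_dep xpredT (fun _ l => ~~ l)
      (fun a l => letter_monomial alpha beta k (b, i) (a, l))) /=.
    apply: eq_bigr => a _; rewrite (big_pred1 false); last by case.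
    rewrite /letter_monomial /= ik expr0 mulr1 addn0 exprZn -scalerAl -exprSr add1n.
    by [].
  rewrite -mulr_suml mulrA scale1r -[X in low_eq _ _ X]mul1r.
  exact: low_eqM.
case: (boolP (active k b i)) => act; last first.
  have -> : L = 1.
    rewrite -absent ?nik2 //.
    by apply: eq_bigl => al; rewrite /letter_ok /= nik nik2 (negbTE act).
  by rewrite mulr1.
have -> : L = (\sum_(a < d.+1) (- alpha (box_col b) *: X) ^+ a) *
    (1 - beta (box_row b) *: X).
  rewrite /L (eq_bigl xpredT); last first.
    by move=> al; rewrite /letter_ok /= nik nik2 act.
  rewrite -(pair_bigA _ (fun a l => letter_monomial alpha beta k (b, i) (a, l))) /=.
  rewrite mulr_suml; apply: eq_bigr => a _.
  rewrite big_bool /letter_monomial /= nik2 expr0 expr1 mulr1 add0n addn0 addn1.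
  rewrite exprZn exprSr mulrBr mulr1 addrC; congr (_ + _).
  by rewrite mulrN scaleNr -scalerAl -scalerAr scalerA.
rewrite mulrA -[X in low_eq _ _ X]mul1r.
exact: low_eqM.
Qed.

Lemma rational_value_G_skew (x : 'I_n -> R) :
  (forall (b : skew_box lam nu) i, 1 + alpha (box_col b) * x i != 0) ->
  rational_value (G_skew alpha beta lam nu) x
    (\sum_(k : {ffun skew_box lam nu -> 'I_n}) \prod_b \prod_i letter_value x k b i).
Proof.
move=> x0.
have ev bi : meval x (letter_denom bi) = 1 + alpha (box_col bi.1) * x bi.2.
  by rewrite /letter_denom mevalD meval1 mevalZ mevalXU.
have evB : meval x (\prod_bi letter_denom bi) != 0.
  by rewrite rmorph_prod; apply/prodf_neq0 => bi _; rewrite /= ev.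
exists (\sum_k \prod_bi letter_num k bi), (\prod_bi letter_denom bi); split => //.
  move=> m; have md := ltnSn (mdeg m).
  (* Only coefficients of degree at most [mdeg m] matter, so the truncation may be replaced by the
     polynomial of [G_skew_coef]. *)
  rewrite (@mcoeffM_congr _ _ (mdeg m).+1 _ (\sum_(k : {ffun skew_box lam nu -> 'I_n})
    \prod_(bi : skew_box lam nu * 'I_n)
      \sum_(al : 'I_(mdeg m).+1 * bool | letter_ok k bi al)
        letter_monomial alpha beta k bi al)) //; last first.
    by move=> m' m'd; rewrite mcoeff_truncation // (G_skew_coef _ _ _ _ _ _ m'd).
  move: md; apply: (_ : low_eq (mdeg m).+1 _ _); rewrite mulr_sumr.
  apply: low_eq_sum => k; rewrite -big_split /=; apply: low_eq_prod => bi.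
  exact: letter_sum_low.
rewrite raddf_sum /= mulr_suml; apply: eq_bigr => k _.
rewrite !rmorph_prod /= -prodf_div pair_bigA; apply: eq_bigr => -[b i] _ /=.
rewrite ev /letter_value /letter_num /=; have x0bi := x0 b i.
case: ifP => _; first by rewrite ev divff.
case: ifP => _; first by rewrite mevalZ mevalXU mulrA.
case: ifP => _; last by rewrite ev divff.
by rewrite mevalB meval1 mevalZ mevalXU.
Qed.
End skew_value.

(** * Corner letters on a rectangle *)

Lemma mem_boxes (lam nu : seq nat) (r c : nat) :
  ((r, c) \in boxes lam nu) = (0 < r)%N && (part nu r < c <= part lam r)%N.
Proof.
apply/allpairsPdep/idP => [[r' [c' [+ + [-> ->]]]]|].
  rewrite !mem_iota => /andP[-> _]; lia.
case: r => // r /andP[_ rc]; exists r.+1, c; rewrite !mem_iota; split => //.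
  rewrite /=; case: (ltnP r (size lam)) => [//|sr].
  by move: rc; rewrite /part /= (nth_default 0%N sr); lia.
by move: rc; lia.
Qed.

Lemma box_bounds {lam nu : seq nat} (b : skew_box lam nu) :
  (0 < box_row b)%N && (part nu (box_row b) < box_col b <= part lam (box_row b))%N.
Proof. by case: b => -[r c] bs; rewrite -mem_boxes. Qed.

Lemma boxes_uniq (lam nu : seq nat) : uniq (boxes lam nu).
Proof.
apply: allpairs_uniq_dep => [|r _|]; [exact: iota_uniq|exact: iota_uniq|].
by move=> [a b] [a' b'] _ _ /= [-> ->].
Qed.

Lemma prod_boxes {R : comPzSemiRingType} (ell : nat) (lam nu : seq nat)
    (f : nat * nat -> R) : (size lam <= ell)%N ->
  \prod_(b <- boxes lam nu) f b =
  \prod_(r < ell) \prod_(part nu r.+1 <= c < part lam r.+1) f (r.+1, c.+1).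
Proof.
move=> ll; rewrite big_allpairs_dep /=.
have -> : iota 1 (size lam) = index_iota 1 (size lam).+1 by rewrite /index_iota subn1.
rewrite big_add1 /= big_mkord.
rewrite -(big_mkord xpredT (fun r => \prod_(part nu r.+1 <= c < part lam r.+1) f
  (r.+1, c.+1))).
rewrite (big_cat_nat (n := size lam)) //= [X in _ = _ * X]big1_seq ?mulr1; last first.
  move=> r; rewrite mem_index_iota => /andP[_ /andP[sr _]].
  by rewrite {2}/part /= nth_default // big_geq.
rewrite big_mkord; apply: eq_bigr => r _.
rewrite -(big_add1 _ _ (part nu r.+1) (part lam r.+1).+1 xpredT (fun c => f (r.+1, c))).
by rewrite /index_iota subSS.
Qed.

Lemma prod_seq_sub {R : comPzSemiRingType} {T : choiceType} (s : seq T) (f : T -> R) :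
  uniq s -> \prod_(b : seq_sub s) f (ssval b) = \prod_(b <- s) f b.
Proof.
move=> us; rewrite -(big_map (@ssval _ s) xpredT) /=.
apply: perm_big; apply: uniq_perm => //.
  by rewrite map_inj_uniq ?index_enum_uniq //; exact: val_inj.
move=> b; apply/mapP/idP => [[b' _ ->]|bs]; first exact: ssvalP.
by exists (SeqSub bs); rewrite ?mem_index_enum.
Qed.

Section rectangle.
Context {R : realType} {ell N M : nat} (alpha beta x : nat -> R).
Implicit Types (K : {ffun 'I_ell * 'I_N -> 'I_M.+1}) (s nu lam : nat -> nat).

(* The letter M stands for boxes which remain empty. *)
Definition letter_at K (r c : nat) : nat :=
  if insub r is Some r' then
    if insub c is Some c' then K (r', c') : nat else M else M.

Lemma letter_at_in K (r : 'I_ell) (c : 'I_N) : letter_at K r c = K (r, c).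
Proof. by rewrite /letter_at !valK. Qed.

Lemma letter_at_out K (r c : nat) :
  (ell <= r)%N || (N <= c)%N -> letter_at K r c = M.
Proof.
rewrite /letter_at => /orP[] h; first by rewrite insubN // -leqNgt.
by case: insubP => // r' _ _; rewrite insubN // -leqNgt.
Qed.

Definition act K (r c i : nat) : bool :=
  (i <= letter_at K r c.+1)%N && (i < letter_at K r.+1 c)%N.

Definition box_step (r c i : nat) : R :=
  (1 - beta r.+1 * x i) / (1 + alpha c.+1 * x i).

(** The factor of the letter i >= 1 in a box. A box with letter 0 never meets the corner case and
    gives [box_step] at each active letter; a box with letter M gives 1 for all i < M. Hence filled
    and empty boxes need no separate treatment. *)
Definition phi K (r c i : nat) : R :=
  if (i < letter_at K r c)%N then 1
  else if i == letter_at K r c then (act K r c i)%:R * (x i / (1 + alpha c.+1 * x i))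
  else if act K r c i then box_step r c i
  else 1.

(* K encodes a growth from nu to lam with letters 1, ..., n. *)
Definition growth n nu lam K : bool :=
  [forall b : 'I_ell * 'I_N,
    if (b.2 < nu b.1)%N then K b == 0%N :> nat
    else if (b.2 < lam b.1)%N then (0 < K b <= n)%N
    else K b == M :> nat].

End rectangle.

(** * Skew tableaux as fillings of the rectangle *)

Section skew_rectangle.
Context {R : realType} {ell N M n : nat} (alpha beta x : nat -> R).
Context {lam nu : seq nat}.
Hypotheses (lam_ell : (size lam <= ell)%N) (nM : (n < M)%N).
Hypothesis lam_N : forall r, (part lam r.+1 <= N)%N.
Hypothesis nu_lam : forall r, (part nu r.+1 <= part lam r.+1)%N.
Hypothesis nu_dec : forall r, (part nu r.+2 <= part nu r.+1)%N.
Implicit Types (k : {ffun skew_box lam nu -> 'I_n}).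

Local Notation rect := ('I_ell * 'I_N)%type.
Local Notation rows s := (fun r => part s r.+1).

Definition extend_letters k : {ffun rect -> 'I_M.+1} :=
  [ffun b : rect => if (b.2 < part nu b.1.+1)%N then ord0
    else if insub (b.1.+1, b.2.+1) is Some b' then inord (k b').+1 else ord_max].

Let row_lt r c : (c < part lam r.+1)%N -> (r < ell)%N.
Proof.
move=> h; apply: leq_trans lam_ell; rewrite ltnNge; apply/negP => sr.
by move: h; rewrite /part /= nth_default.
Qed.

Let col_lt r c : (c < part lam r.+1)%N -> (c < N)%N.
Proof. by move=> h; apply: leq_trans (lam_N r). Qed.

Lemma extend_letters_box k (b : skew_box lam nu) :
  letter_at (extend_letters k) (box_row b).-1 (box_col b).-1 = (k b).+1.
Proof.
case: b => -[r c] bs; rewrite /box_row /box_col /=.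
have := bs; rewrite mem_boxes => /andP[r0 /andP[c1 c2]].
case: r c r0 c1 c2 bs => // r [//|c] _ c1 c2 bs /=.
rewrite -[r]/(val (Ordinal (row_lt _ _ c2))) -[c]/(val (Ordinal (col_lt _ _ c2))).
rewrite letter_at_in ffunE /= ltnNge -ltnS c1 /= (insubT (fun b => b \in boxes lam
  nu) bs) /=.
rewrite inordK; last by apply: leq_trans (ltn_ord _) _; rewrite ltnW // ltnW.
congr (k _).+1; exact: val_inj.
Qed.

Lemma extend_letters_out k (r c : nat) :
  (part lam r.+1 <= c)%N -> letter_at (extend_letters k) r c = M.
Proof.
move=> lc; case: (ltnP r ell) => re; last by rewrite letter_at_out ?re.
case: (ltnP c N) => cN; last by rewrite letter_at_out ?cN ?orbT.
rewrite -[r]/(val (Ordinal re)) -[c]/(val (Ordinal cN)) letter_at_in ffunE /=.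
rewrite ltnNge (leq_trans (nu_lam _) lc) /= insubN //.
by rewrite mem_boxes /=; lia.
Qed.

(** Neighbours outside lam carry the letter M > n and impose nothing. As nu is decreasing, the right
    and lower neighbours of a box of lam/nu are never boxes of nu, whose letter 0 would block
    everything. *)
Lemma active_act k (b : skew_box lam nu) (i : 'I_n) :
  active k b i = act (extend_letters k) (box_row b).-1 (box_col b).-1 i.+1.
Proof.
have /andP[r0 /andP[c1 c2]] := box_bounds b.
set r := (box_row b).-1; set c := (box_col b).-1.
have rE : box_row b = r.+1 by rewrite prednK.
have cE : box_col b = c.+1 by rewrite prednK //; apply: leq_ltn_trans c1.
rewrite rE cE in c1 c2; apply/forallP/andP => [A|[A1 A2] b'].
  split.
    case: (leqP (part lam r.+1) c.+1) => h.
      by rewrite extend_letters_out // (leq_trans (ltn_ord i)) // ltnW.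
    have bs : (r.+1, c.+2) \in boxes lam nu by rewrite mem_boxes /= h andbT ltnW.
    have /andP[/implyP + _] := A (SeqSub bs); rewrite /right_of rE cE /=.
    rewrite /box_row /box_col /= !eqxx => /(_ isT) h2.
    by have := extend_letters_box k (SeqSub bs); rewrite /box_row /box_col /= => ->.
  case: (leqP (part lam r.+2) c) => h.
    by rewrite extend_letters_out // (leq_ltn_trans (ltn_ord i)).
  have bs : (r.+2, c.+1) \in boxes lam nu.
    by rewrite mem_boxes /= h andbT; apply: leq_ltn_trans c1.
  have /andP[_ /implyP] := A (SeqSub bs); rewrite /below rE cE /=.
  rewrite /box_row /box_col /= !eqxx => /(_ isT) h2.
  by have := extend_letters_box k (SeqSub bs); rewrite /box_row /box_col /= => ->.
have kb' := extend_letters_box k b'.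
apply/andP; split; apply/implyP => /andP[/eqP r' /eqP c'].
  by move: kb' A1; rewrite r' c' cE /= -/r => ->.
by move: kb' A2; rewrite r' c' rE /= -/c => ->.
Qed.

Lemma extend_letters_value k (b : skew_box lam nu) (i : 'I_n) :
  letter_value alpha beta (fun j : 'I_n => x j.+1) k b i =
  phi alpha beta x (extend_letters k) (box_row b).-1 (box_col b).-1 i.+1.
Proof.
have /andP[r0 /andP[c1 c2]] := box_bounds b.
rewrite /letter_value /phi extend_letters_box ltnS eqSS -active_act /box_step.
rewrite !prednK //; by apply: leq_ltn_trans c1.
Qed.

Lemma growth_extend K :
  growth n (rows nu) (rows lam) K -> exists k, K = extend_letters k.
Proof.
move=> /forallP gK.
have gK' (r c : nat) : (part nu r.+1 <= c < part lam r.+1)%N ->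
    (0 < letter_at K r c <= n)%N.
  move=> /andP[h1 h2]; have := gK (Ordinal (row_lt _ _ h2), Ordinal (col_lt _ _ h2)).
  by rewrite /= ltnNge h1 h2 /= -letter_at_in.
have kP (b : skew_box lam nu) : ((letter_at K (box_row b).-1 (box_col b).-1).-1 < n)%N.
  have h := box_bounds b.
  case: (box_row b) (box_col b) h => // r [|c] //= h.
  by have := gK' r c; lia.
exists [ffun b => Ordinal (kP b)]; apply/ffunP => b; rewrite ffunE.
have := gK b; case: b => r c /=; case: ifP => [_ /eqP rc|/negbT rc];
  first exact: val_inj.
rewrite -leqNgt in rc; case: ifP => [h|/negbT h].
  have bs : (r.+1, c.+1) \in boxes lam nu by rewrite mem_boxes /= ltnS rc h.
  move=> /andP[k0 kn]; rewrite (insubT (fun b => b \in boxes lam nu) bs) /= ffunE /=.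
  have e : (letter_at K (box_row (SeqSub bs)).-1 (box_col (SeqSub bs)).-1).-1.+1 = K
    (r, c).
    by rewrite /box_row /box_col /= letter_at_in prednK.
  by apply/val_inj; rewrite /= inordK /= ?e ?ltn_ord.
rewrite insubN; first by move=> /eqP rc'; apply/val_inj.
by rewrite mem_boxes /= (negbTE h) andbF.
Qed.

Lemma sum_letters :
  \sum_(k : {ffun skew_box lam nu -> 'I_n}) \prod_b \prod_i
     letter_value alpha beta (fun j : 'I_n => x j.+1) k b i =
  \sum_(K : {ffun rect -> 'I_M.+1} | growth n (rows nu) (rows lam) K)
    \prod_(b : rect | (part nu b.1.+1 <= b.2)%N) \prod_(1 <= i < n.+1)
      phi alpha beta x K b.1 b.2 i.
Proof.
have injK : injective extend_letters.
  move=> k k' kk; apply/ffunP => b; apply/val_inj/succn_inj.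
  by rewrite -!extend_letters_box kk.
rewrite (eq_bigl (fun K => K \in extend_letters @: [set: {ffun skew_box lam nu ->
  'I_n}]%SET)).
  rewrite big_imset /=; last by move=> k k' _ _; exact: injK.
  apply: eq_big => [k|k _]; first by rewrite inE.
  under eq_bigr do under eq_bigr do rewrite extend_letters_value.
  pose f (rc : nat * nat) :=
    \prod_(i < n) phi alpha beta x (extend_letters k) rc.1.-1 rc.2.-1 i.+1.
  rewrite (prod_seq_sub (boxes lam nu) f) ?boxes_uniq // (prod_boxes ell) //.
  pose g r c := \prod_(i < n) phi alpha beta x (extend_letters k) r c i.+1.
  rewrite (eq_bigr (fun b : rect => g b.1 b.2)); last first.
    by move=> b _; rewrite big_add1 /= big_mkord.
  rewrite (eq_bigl (fun b : rect => xpredT b.1 && (part nu b.1.+1 <= b.2)%N)) //.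
  rewrite -(pair_big_dep xpredT (fun (r : 'I_ell) (c : 'I_N) => (part nu r.+1 <= c)%N)
    (fun (r : 'I_ell) (c : 'I_N) => g r c)) /=.
  apply: eq_bigr => r _; rewrite -(big_mkord (fun c => part nu r.+1 <= c)%N (g r)).
  have le1 := nu_lam r; have le2 := lam_N r.
  rewrite [RHS](big_cat_nat (n := part lam r.+1)) //=.
  (* Beyond lam the letter M exceeds n, so these boxes contribute 1. *)
  rewrite [X in _ = _ * X]big1_seq ?mulr1; last first.
    move=> c; rewrite mem_index_iota => /andP[_ /andP[h _]].
    rewrite /g big1 // => i _; rewrite /phi extend_letters_out //.
    by rewrite (leq_ltn_trans (ltn_ord i)).
  by rewrite (big_nat_widenl _ 0).
move=> K; apply/idP/imsetP => [/growth_extend[k ->]|[k _ ->]]; first by exists k.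
apply/forallP => -[r c] /=; case: ifP => [h|/negbT h]; first by rewrite ffunE /= h.
rewrite -leqNgt in h; case: ifP => [h2|/negbT h2]; last first.
  by rewrite -letter_at_in extend_letters_out // leqNgt.
have bs : (r.+1, c.+1) \in boxes lam nu by rewrite mem_boxes /= ltnS h h2.
rewrite -letter_at_in; have := extend_letters_box k (SeqSub bs).
by rewrite /box_row /box_col /= => ->; rewrite /= ltn_ord.
Qed.

End skew_rectangle.

(** * Removing corners *)

(** Induction on n, with S the sum so far: an active letter n + 1 multiplies S - 1 by y and adds w z
    = y - 1, and 1 + (S - 1) y + (y - 1) = S y. An inactive one changes nothing. *)
Lemma corner_telescope {R : comNzRingType} (a : nat -> bool) (y z : nat -> R) (w : R)
    (n : nat) : (forall i, (0 < i <= n)%N -> w * z i = y i - 1) ->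
  1 + \sum_(1 <= v < n.+1) w * \prod_(1 <= i < n.+1)
        (if (i < v)%N then 1 else if i == v then (a i)%:R * z i
         else if a i then y i else 1) =
  \prod_(1 <= i < n.+1) (if a i then y i else 1).
Proof.
elim: n => [|n IH] wz; first by rewrite !big_geq // addr0.
rewrite [RHS]big_nat_recr //= -IH; last by move=> i ni; apply: wz; lia.
rewrite big_nat_recr //= [X in w * X]big_nat_recr //= ltnn eqxx.
rewrite [X in w * (X * _)]big1_seq ?mul1r; last first.
  by move=> i; rewrite mem_index_iota => /andP[_ /andP[_ ->]].
rewrite (eq_big_nat _ _ (F2 := fun v => w * (\prod_(1 <= i < n.+1)
  (if (i < v)%N then 1 else if i == v then (a i)%:R * z i
         else if a i then y i else 1)) * (if a n.+1 then y n.+1 else 1))); last first.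
  move=> v /andP[v1 vn]; rewrite big_nat_recr //= mulrA.
  by rewrite ltnNge (ltnW vn) /= gtn_eqF.
rewrite -mulr_suml; case: (a n.+1) => /=; last by rewrite mul0r mulr0 addr0 !mulr1.
by rewrite mul1r (wz n.+1) ?ltnSn //; ring.
Qed.

Section corners.
Context {R : realType} {ell N M n : nat} (alpha beta x : nat -> R).
Context {lam mu : seq nat}.
Hypotheses (mu_ell : (size mu <= ell)%N) (nM : (n < M)%N).
Hypothesis mu_N : forall r, (part mu r.+1 <= N)%N.
Hypothesis mu_lam : forall r, (part mu r.+1 <= part lam r.+1)%N.
Hypothesis mu_dec : forall r, (part mu r.+2 <= part mu r.+1)%N.
Hypothesis denom_neq0 : forall c i, (0 < i <= n)%N -> 1 + alpha c.+1 * x i != 0.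

Local Notation rect := ('I_ell * 'I_N)%type.
Local Notation rows s := (fun r => part s r.+1).
Implicit Types (K : {ffun rect -> 'I_M.+1}) (S : {set 'I_(size mu)}).

Let mu_row r c : (c < part mu r.+1)%N -> (r < size mu)%N.
Proof.
move=> h; rewrite ltnNge; apply/negP => sr.
by move: h; rewrite /part /= nth_default.
Qed.

Lemma part_remove_corners S (r : nat) :
  part (remove_corners S) r.+1 =
  (part mu r.+1 - (if insub r is Some r' then r' \in S else false))%N.
Proof.
rewrite /part /=; case: insubP => [r' rs re|rs].
  have {r' re} -> : r' = Ordinal rs by exact: val_inj.
  rewrite /remove_corners (nth_map (Ordinal rs)) ?size_enum_ord //.
  by have -> : nth (Ordinal rs) (enum 'I_(size mu)) r = Ordinal rs
    by exact: (nth_ord_enum (Ordinal rs) (Ordinal rs)).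
rewrite -leqNgt in rs.
by rewrite !nth_default // /remove_corners size_map size_enum_ord.
Qed.

Definition is_corner (r c : nat) : bool := (c.+1 == part mu r.+1) && (part mu r.+2 <=
  c)%N.

Lemma corner_rowsP S : corner_rows S ->
  forall r (rs : (r < size mu)%N), Ordinal rs \in S -> is_corner r (part mu r.+1).-1.
Proof.
move=> /forall_inP cS r rs /cS /= h; rewrite /is_corner; lia.
Qed.

(** A set of removed corners together with a growth from the remaining shape is merged into one
    filling: a corner of mu has letter 0 if it is kept and its own letter if it is removed.
    [filled_corners] recovers the set. *)
Definition corner_growth (b : rect) : pred 'I_M.+1 := fun v =>
  if (b.2 < part mu b.1.+1)%N then
    (if is_corner b.1 b.2 then (v <= n)%N else v == 0%N :> nat)
  else if (b.2 < part lam b.1.+1)%N then (0 < v <= n)%N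
  else v == M :> nat.

Definition filled_corners K : {set 'I_(size mu)} :=
  [set r : 'I_(size mu) | is_corner r (part mu r.+1).-1 &&
     (letter_at K r (part mu r.+1).-1 != 0%N)]%SET.

Let growth_remove S K : corner_rows S ->
  growth n (rows (remove_corners S)) (rows lam) K =
  (K \in family corner_growth) && (filled_corners K == S).
Proof.
move=> cS; have cP := corner_rowsP S cS.
apply/forallP/andP => [gK|[/familyP fK /eqP KS] b].
  split.
    apply/familyP => -[r c]; have := gK (r, c).
    rewrite -topredE /= /corner_growth /= part_remove_corners.
    case: ltnP => [h|h].
      have -> : (c < part mu r.+1)%N by lia.
      by move=> /eqP ->; rewrite leq0n; case: ifP.
    case: insubP h => [r' rs re|rs] /=; last first.
      by rewrite subn0 => h; rewrite [(c < part mu r.+1)%N]ltnNge h.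
    case: (boolP (r' \in S)) => rS /=; last by rewrite subn0 => h;
      rewrite [(c < part mu r.+1)%N]ltnNge h.
    move=> h; case: (ltnP c (part mu r.+1)) => // h2.
    have : is_corner r (part mu r.+1).-1.
      apply: (cP _ rs); rewrite (_ : Ordinal rs = r') //; exact: val_inj.
    have -> : (part mu r.+1).-1 = c by lia.
    by move=> ->; rewrite (leq_trans h2 (mu_lam _)) => /andP[].
  apply/eqP/setP => r; rewrite inE.
  case: (boolP (is_corner _ _)) => [cr|ncr] /=; last first.
    by apply/esym/negP => rS; move: ncr;
      rewrite (cP _ (ltn_ord r)) //= (_ : Ordinal _ = r) //; exact: val_inj.
  have c0 : (0 < part mu r.+1)%N by case/andP: cr => /eqP <-.
  have rl : (r < ell)%N by exact: leq_trans (ltn_ord r) mu_ell.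
  have cN : ((part mu r.+1).-1 < N)%N by rewrite prednK.
  have := gK (Ordinal rl, Ordinal cN).
  rewrite -[in letter_at _ _ _](_ : val (Ordinal rl) = r) //.
  rewrite -[in letter_at _ _ _](_ : val (Ordinal cN) = (part mu r.+1).-1) //.
  rewrite letter_at_in /= part_remove_corners valK.
  case: (r \in S).
    rewrite subn1 ltnn prednK // (mu_lam r) => /andP[k0 _]; by rewrite -lt0n.
  by rewrite subn0 prednK // leqnn => /eqP ->.
have := fK b; case: b => r c /=;
  rewrite -topredE /= /corner_growth /= part_remove_corners.
case: insubP => [r' rs re|rs] /=; last first.
  have m0 : part mu r.+1 = 0%N by rewrite /part /= nth_default // leqNgt.
  by rewrite m0 /=.
have rr' : part mu r'.+1 = part mu r.+1 by rewrite re.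
rewrite -KS inE rr'.
case: ltnP => h /=.
  case: (boolP (is_corner r c)) => [cr|ncr].
    have cE : (part mu r.+1).-1 = c by case/andP: cr => /eqP <-.
    rewrite cE re cr letter_at_in /=;
      case: (boolP (K (r, c) == 0%N :> nat)) => /= k0 kn.
      by rewrite subn0 h.
    have -> : (c < part mu r.+1 - 1)%N = false by lia.
    by rewrite (leq_trans h (mu_lam _)) lt0n k0.
  move=> k0; case: (boolP (is_corner _ _)) => cr; last by rewrite subn0 h.
  have ne : c.+1 != part mu r.+1.
    apply: contra ncr => /eqP ce; move: cr; rewrite re -ce /is_corner /=; lia.
  have lt (t : bool) : (c < part mu r.+1 - t)%N by case: t => /=; lia.
  by rewrite lt.
have lt (t : bool) : (c < part mu r.+1 - t)%N = false by case: t => /=; lia.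
by rewrite lt.
Qed.

Definition clear K : {ffun rect -> 'I_M.+1} :=
  [ffun b : rect => if (b.2 < part mu b.1.+1)%N then ord0 else K b].

Lemma letter_at_clear K (r c : nat) : (part mu r.+1 <= c)%N ->
  letter_at (clear K) r c = letter_at K r c.
Proof.
move=> h; case: (ltnP r ell) => re; last by rewrite !letter_at_out ?re.
case: (ltnP c N) => cN; last by rewrite !letter_at_out ?cN ?orbT.
rewrite -[r]/(val (Ordinal re)) -[c]/(val (Ordinal cN)) !letter_at_in ffunE /=.
by rewrite ltnNge h.
Qed.

(** [phi] with the letter of the box and its activity as separate arguments, so that the letter can
    vary while the neighbours come from a fixed K. *)
Definition phi_with (v : nat) (a : bool) (r c i : nat) : R :=
  if (i < v)%N then 1
  else if i == v then a%:R * (x i / (1 + alpha c.+1 * x i))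
  else if a then box_step alpha beta x r c i else 1.

Definition corner_weight K (b : rect) (v : nat) : R :=
  if v == 0%N then 1 else
  (if (b.2 < part mu b.1.+1)%N then - (alpha b.2.+1 + beta b.1.+1) else 1) *
  \prod_(1 <= i < n.+1) phi_with v (act K b.1 b.2 i) b.1 b.2 i.

(** The right and lower neighbours of a corner of mu lie outside mu, where [clear] changes nothing.
    So the letters in the corners do not influence each other and can be summed independently. *)
Lemma corner_weight_clear K (b : rect) : K \in family corner_growth ->
  corner_weight K b (K b) = corner_weight (clear K) b (K b).
Proof.
move=> /familyP/(_ b); rewrite -topredE /= /corner_growth => Kb.
rewrite /corner_weight; case: eqP => // /eqP k0.
have out : (part mu b.1.+1 <= b.2)%N || is_corner b.1 b.2.
  move: Kb; case: (ltnP b.2 (part mu b.1.+1)) => //= _; case: ifP => // _.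
  by rewrite (negbTE k0).
congr (_ * _); apply: eq_bigr => i _; congr phi_with.
rewrite /act !letter_at_clear //.
  by case/orP: out => [h|/andP[_ //]]; exact: leq_trans (mu_dec _) _.
by case/orP: out => [h|/andP[/eqP <- _]] //; exact: ltnW.
Qed.

Lemma corner_weight_sum K (b : rect) : growth n (rows mu) (rows lam) K ->
  \sum_(v : 'I_M.+1 | if (b.2 < part mu b.1.+1)%N then corner_growth b v else v == K b)
     corner_weight K b v =
  \prod_(1 <= i < n.+1) phi alpha beta x K b.1 b.2 i.
Proof.
move=> /forallP gK; have := gK b; case: ifP => [h /eqP k0|/negbT h]; last first.
  move=> kb; rewrite (big_pred1 (K b)) // /corner_weight (negbTE h) mul1r.
  have -> : (K b == 0%N :> nat) = false.
    move: kb; case: ifP => [_ /andP[k0 _]|_ /eqP ->]; first by rewrite gtn_eqF.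
    by rewrite gtn_eqF //; exact: leq_ltn_trans nM.
  by apply: eq_bigr => i _; case: b {h kb} => r c; rewrite /phi letter_at_in.
have phi0 i : (0 < i)%N -> phi alpha beta x K b.1 b.2 i =
    if act K b.1 b.2 i then box_step alpha beta x b.1 b.2 i else 1.
  case: b k0 {h} => r c k0 i0 /=; rewrite /phi letter_at_in k0 ltn0.
  by rewrite gtn_eqF.
rewrite (eq_big_nat _ _ (F2 := fun i => if act K b.1 b.2 i then box_step alpha beta x
  b.1 b.2 i else 1)); last first.
  by move=> i /andP[i0 _]; exact: phi0.
rewrite /corner_growth h.
case: (boolP (is_corner b.1 b.2)) => cr; last first.
  rewrite (big_pred1 ord0); last by [].
  rewrite /corner_weight /= big1_seq // => i;
    rewrite mem_index_iota => /andP[_ /andP[i0 _]].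
  (* A box of mu that is not a corner has its right or lower neighbour in mu, with letter 0, so no
     letter i >= 1 is active in it. *)
  suff -> : act K b.1 b.2 i = false by [].
  have K0 (r c : nat) : (c < part mu r.+1)%N -> letter_at K r c = 0%N.
    move=> h2; have re : (r < ell)%N by apply: leq_trans (mu_row _ _ h2) mu_ell.
    have cN : (c < N)%N by apply: leq_trans h2 (mu_N _).
    have := gK (Ordinal re, Ordinal cN); rewrite /= h2 => /eqP.
    by rewrite -letter_at_in.
  apply/negP => /andP[a1 a2]; move: cr; rewrite /is_corner negb_and => /orP[c1|c2].
    have h2 : (b.2.+1 < part mu b.1.+1)%N by rewrite ltn_neqAle c1 h.
    by move: a1; rewrite K0 // leqn0 gtn_eqF.
  by move: a2; rewrite K0 // ltnNge.
have -> : \sum_(v < M.+1 | (v <= n)%N) corner_weight K b v =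
    \sum_(0 <= v < n.+1) corner_weight K b v.
  rewrite (big_nat_widen 0 n.+1 M.+1); last by rewrite ltnS ltnW.
  by rewrite [RHS]big_mkord; apply: eq_bigl => v; rewrite ltnS.
rewrite [LHS]big_ltn //.
rewrite {1}/corner_weight /=.
have tele := corner_telescope (act K b.1 b.2) (box_step alpha beta x b.1 b.2)
  (fun i => x i / (1 + alpha b.2.+1 * x i)) (- (alpha b.2.+1 + beta b.1.+1)) n.
apply: etrans (tele _); last first.
  by move=> i i0; rewrite /box_step; field; exact: denom_neq0.
congr (1 + _); apply: eq_big_nat => v /andP[v0 _].
by rewrite /corner_weight gtn_eqF // h.
Qed.

(** Both sides sum the same weights over the fillings in [corner_growth], grouped on the left by the
    set of filled corners and on the right by what remains after [clear]. *)
Lemma sum_corners :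
  \sum_(S : {set 'I_(size mu)} | corner_rows S)
    (\prod_(b <- boxes mu (remove_corners S)) - (alpha b.2 + beta b.1)) *
    \sum_(K : {ffun rect -> 'I_M.+1} | growth n (rows (remove_corners S)) (rows lam) K)
      \prod_(b : rect | (part (remove_corners S) b.1.+1 <= b.2)%N)
        \prod_(1 <= i < n.+1) phi alpha beta x K b.1 b.2 i =
  \sum_(K : {ffun rect -> 'I_M.+1} | growth n (rows mu) (rows lam) K)
    \prod_(b : rect) \prod_(1 <= i < n.+1) phi alpha beta x K b.1 b.2 i.
Proof.
transitivity (\sum_(K in family corner_growth) \prod_(b : rect) corner_weight K b (K
  b)).
  rewrite (partition_big filled_corners (fun S => corner_rows S)) /=; last first.
    move=> K _; apply/forall_inP => r; rewrite inE => /andP[/andP[/eqP h1 h2] _]; lia.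
  apply: eq_bigr => S cS; rewrite mulr_sumr; apply: eq_big => K;
    first exact: growth_remove.
  move=> gK.
  rewrite (prod_boxes ell) //=.
  pose g (r c : nat) := if (part (remove_corners S) r.+1 <= c < part mu r.+1)%N then
     - (alpha c.+1 + beta r.+1) else 1.
  have -> : \prod_(r < ell) \prod_(part (remove_corners S) r.+1 <= c < part mu r.+1)
      - (alpha c.+1 + beta r.+1) = \prod_(b : rect) g b.1 b.2.
    rewrite -(pair_bigA _ (fun (r : 'I_ell) (c : 'I_N) => g r c)) /=.
    apply: eq_bigr => r _; rewrite -(big_mkord xpredT (g r)) /g -big_mkcond /=.
    rewrite (big_nat_widenl _ 0) // (big_nat_widen _ _ N) //=.
  rewrite [X in _ * X]big_mkcond -big_split /=; apply: eq_bigr => -[r c] _ /=.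
  rewrite /g /corner_weight; have /forallP/(_ (r, c)) := gK; rewrite /=.
  have rm : (part (remove_corners S) r.+1 <= part mu r.+1)%N.
    by rewrite part_remove_corners leq_subr.
  case: ltnP => [h /eqP ->|h]; first by rewrite /= mul1r.
  move=> kb; have -> : (K (r, c) == 0%N :> nat) = false.
    move: kb; case: ifP => [_ /andP[k0 _]|_ /eqP ->]; first by rewrite gtn_eqF.
    by rewrite gtn_eqF //; exact: leq_ltn_trans nM.
  rewrite /=; congr (_ * _); apply: eq_bigr => i _; by rewrite /phi letter_at_in.
rewrite (partition_big clear (growth n (rows mu) (rows lam))) /=; last first.
  move=> K /familyP fK; apply/forallP => b; have := fK b.
  by rewrite -topredE /= /corner_growth ffunE; case: (b.2 < part mu b.1.+1)%N.
apply: eq_bigr => K0 gK0.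
(* Expanding the product of these sums chooses a letter for every corner of mu, which is the same as
   a filling K with [clear K = K0]. *)
under [RHS]eq_bigr => b _ do rewrite -(corner_weight_sum K0 b gK0).
rewrite bigA_distr_big_dep; apply: eq_big => K; last first.
  by move=> /andP[fK /eqP <-]; apply: eq_bigr => b _; exact: corner_weight_clear.
apply/andP/familyP => [[/familyP fK /eqP <-] b|fK].
  by have := fK b; rewrite -!topredE /= ffunE /corner_growth;
    case: (b.2 < part mu b.1.+1)%N.
split; last first.
  apply/eqP/ffunP => b; rewrite ffunE; have := fK b; rewrite -topredE /=.
  case: ifP => [h _|_ /eqP //]; have /forallP/(_ b) := gK0; rewrite h => /eqP k0.
  exact/val_inj.
apply/familyP => b; have := fK b; rewrite -!topredE /=; case: ifP => // h /eqP ->.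
by have /forallP/(_ b) := gK0; rewrite /corner_growth h.
Qed.

End corners.

(** * Adding one letter *)

Definition config_row {ell N : nat} (kap : {ffun 'I_ell -> 'I_N.+1}) (r : nat) : nat :=
  if insub r is Some r' then kap r' : nat else 0%N.

Lemma config_row_in {ell N : nat} (kap : {ffun 'I_ell -> 'I_N.+1}) (r : 'I_ell) :
  config_row kap r = kap r.
Proof. by rewrite /config_row valK. Qed.

Lemma config_row_out {ell N : nat} (kap : {ffun 'I_ell -> 'I_N.+1}) (r : nat) :
  (ell <= r)%N -> config_row kap r = 0%N.
Proof. by move=> h; rewrite /config_row insubN // -leqNgt. Qed.

Lemma config_row_le {ell N : nat} (kap : {ffun 'I_ell -> 'I_N.+1}) (r : nat) :
  (config_row kap r <= N)%N.
Proof. by rewrite /config_row; case: insubP => // r' _ _; rewrite -ltnS. Qed.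

Section one_letter.
Context {R : realType} {ell N M : nat} (alpha beta x : nat -> R).

Local Notation rect := ('I_ell * 'I_N)%type.
Local Notation config := {ffun 'I_ell -> 'I_N.+1}.
Implicit Types (K : {ffun rect -> 'I_M.+1}) (kap lam mu : nat -> nat).

Definition growth_sum (n : nat) mu lam : R :=
  \sum_(K : {ffun rect -> 'I_M.+1} | growth n mu lam K)
    \prod_(b : rect) \prod_(1 <= i < n.+1) phi alpha beta x K b.1 b.2 i.

(** The contribution of row r when i is the largest letter. The new boxes must form a horizontal
    strip. Among the old boxes only the last one can also hold i: the others have an older letter to
    their right, and the last one must have no box of lam below it. *)
Definition row_step kap lam (i r : nat) : R :=
  if (kap r <= lam r)%N && (lam r.+1 <= kap r)%N then
    (\prod_(kap r <= c < lam r) (x i / (1 + alpha c.+1 * x i))) *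
    (if (lam r.+1 < kap r)%N then box_step alpha beta x r (kap r).-1 i else 1)
  else 0.

Definition step kap lam (i : nat) : R := \prod_(r < ell) row_step kap lam i r.

Section add_letter.
Context (n : nat) (kap lam mu : nat -> nat).
Hypotheses (nM : (n.+1 < M)%N) (kap_lam : forall r, (kap r <= lam r)%N).
Hypotheses (lam_dec : forall r, (lam r.+1 <= lam r)%N) (lam_N : forall r, (lam r <=
  N)%N).
Hypothesis lam_out : forall r, (ell <= r)%N -> lam r = 0%N.

Definition add_letter K : {ffun rect -> 'I_M.+1} :=
  [ffun b : rect => if (kap b.1 <= b.2 < lam b.1)%N then inord n.+1 else K b].

Definition remove_letter K : {ffun rect -> 'I_M.+1} :=
  [ffun b : rect => if (kap b.1 <= b.2)%N then ord_max else K b].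

Let add_letter_val K : growth n mu kap K -> (forall r, mu r <= kap r)%N ->
  forall r c, letter_at (add_letter K) r c =
    (if c < kap r then letter_at K r c else if c < lam r then n.+1 else M)%N /\
    (if c < kap r then letter_at K r c <= n else letter_at K r c == M)%N.
Proof.
move=> /forallP gK mk r c; case: (ltnP r ell) => re; last first.
  have l0 := lam_out _ re; have := kap_lam r; rewrite l0 leqn0 => /eqP ->.
  by rewrite !letter_at_out ?re //= ltn0 eqxx.
case: (ltnP c N) => cN; last first.
  have lN := leq_trans (lam_N r) cN.
  rewrite !letter_at_out ?cN ?orbT // (ltnNge _ (lam r)) lN /=.
  by rewrite (ltnNge _ (kap r)) (leq_trans (kap_lam r) lN) eqxx.
have := gK (Ordinal re, Ordinal cN).
rewrite -[r]/(val (Ordinal re)) -[c]/(val (Ordinal cN)) !letter_at_in ffunE /=.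
case: (ltnP c (kap r)) => /= h.
  by case: ifP => [_ /eqP ->|_ /andP[_ ->]].
rewrite ltnNge (leq_trans (mk r) h) /= => /eqP kM.
by case: ifP; rewrite kM eqxx ?inordK // ltnS ltnW.
Qed.

(** A letter i <= n is smaller than both n + 1 and M, so it cannot tell a box filled by n + 1 from
    an empty one. *)
Lemma phi_add_letter_old K (r c i : nat) : growth n mu kap K ->
  (forall r, mu r <= kap r)%N -> (i <= n)%N ->
  phi alpha beta x (add_letter K) r c i = phi alpha beta x K r c i.
Proof.
move=> gK mk ni; have v := add_letter_val K gK mk.
have lt r' c' : (i < letter_at (add_letter K) r' c')%N = (i < letter_at K r' c')%N.
  have [-> +] := v r' c'; case: ifP => // _ /eqP ->; case: ifP => // _; lia.
have le r' c' : (i <= letter_at (add_letter K) r' c')%N = (i <= letter_at K r' c')%N.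
  have [-> +] := v r' c'; case: ifP => // _ /eqP ->; case: ifP => // _; lia.
have eq r' c' : (i == letter_at (add_letter K) r' c')%N = (i == letter_at K r' c')%N.
  by rewrite !eqn_leq le (leqNgt (letter_at (add_letter K) r' c')) lt -leqNgt.
by rewrite /phi /act !lt le eq.
Qed.

Lemma phi_add_letter_new K (r : nat) : growth n mu kap K ->
  (forall r, mu r <= kap r)%N ->
  \prod_(0 <= c < N) phi alpha beta x (add_letter K) r c n.+1 =
  row_step kap lam n.+1 r.
Proof.
move=> gK mk; have v := add_letter_val K gK mk.
have right c : (n.+1 <= letter_at (add_letter K) r c.+1)%N = (kap r <= c.+1)%N.
  have [-> +] := v r c.+1; case: ltnP => h; first by lia.
  by move=> _; case: ifP => _ //; lia.
have belo c : (n.+1 < letter_at (add_letter K) r.+1 c)%N = (lam r.+1 <= c)%N.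
  have [-> +] := v r.+1 c; have := kap_lam r.+1; case: (ltnP c (kap r.+1)) => h;
    first by lia.
  by move=> _ _; case: (ltnP c (lam r.+1)) => _; rewrite ?ltnn ?nM.
rewrite /row_step kap_lam /=.
rewrite (big_cat_nat (n := lam r)) //= (big_cat_nat (n := kap r)) //=.
rewrite [X in _ * X = _]big1_seq ?mulr1; last first.
  move=> c; rewrite mem_index_iota => /andP[_ /andP[h _]].
  rewrite /phi; have [-> _] := v r c.
  rewrite (ltnNge _ (kap r)) (leq_trans (kap_lam r) h) /= (ltnNge _ (lam r)) h /= nM.
  by [].
have old : \prod_(0 <= c < kap r) phi alpha beta x (add_letter K) r c n.+1 =
   (if (lam r.+1 < kap r)%N then box_step alpha beta x r (kap r).-1 n.+1 else 1).
  case kE : (kap r) => [|k]; first by rewrite big_geq.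
  have phiE c : (c < k.+1)%N -> phi alpha beta x (add_letter K) r c n.+1 =
      if (k <= c)%N && (lam r.+1 <= c)%N then box_step alpha beta x r c n.+1 else 1.
    move=> h; rewrite /phi /act right belo kE ltnS; have [-> +] := v r c.
    rewrite kE h => ln; have -> : (n.+1 < letter_at K r c)%N = false by lia.
    by have -> : (n.+1 == letter_at K r c)%N = false by lia.
  rewrite big_nat_recr //= phiE // leqnn /= ltnS big1_seq ?mul1r //.
  move=> c; rewrite mem_index_iota => /andP[_ h]; rewrite phiE; last by lia.
  by have -> : (k <= c)%N = false by lia.
rewrite old mulrC.
have new c : (kap r <= c < lam r)%N -> phi alpha beta x (add_letter K) r c n.+1 =
    (lam r.+1 <= c)%N%:R * (x n.+1 / (1 + alpha c.+1 * x n.+1)).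
  move=> /andP[h1 h2]; rewrite /phi /act right belo; have [-> _] := v r c.
  by rewrite (ltnNge c) h1 h2 /= ltnn eqxx (leq_trans h1).
case: (leqP (lam r.+1) (kap r)) => h.
  congr (_ * _); apply: eq_big_nat => c hc; rewrite new //.
  have -> : (lam r.+1 <= c)%N by lia.
  by rewrite mul1r.
(* Now the strip condition fails: the first new box of the row has a box of lam below it, with
   letter at most n + 1, so its own factor is 0. *)
have kl : (kap r < lam r)%N := leq_trans h (lam_dec r).
by rewrite big_ltn // new ?leqnn // leqNgt h !mul0r.
Qed.

Lemma sum_add_letter : (forall r, mu r <= kap r)%N ->
  \sum_(K : {ffun rect -> 'I_M.+1} | growth n.+1 mu lam K &&
      [forall b : rect, (b.2 < kap b.1)%N == (K b <= n)%N])
    \prod_(b : rect) \prod_(1 <= i < n.+2) phi alpha beta x K b.1 b.2 i =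
  growth_sum n mu kap * step kap lam n.+1.
Proof.
move=> mk; rewrite (reindex_onto add_letter remove_letter); last first.
  move=> K /andP[/forallP gK /forallP cK]; apply/ffunP => b; rewrite !ffunE.
  have /eqP := cK b; have := gK b; case: (leqP (kap b.1) b.2) => //= h1.
  rewrite (ltnNge _ (mu _)) (leq_trans (mk _) h1) /=; case: ifP => h2.
    move=> /andP[_ kb] /esym/negbT; rewrite -ltnNge => nk.
    apply/val_inj; rewrite /= inordK; last by rewrite ltnS ltnW.
    by apply/eqP; rewrite eqn_leq nk kb.
  by move=> /eqP kb _; exact/val_inj.
rewrite /growth_sum mulr_suml; apply: eq_big => [K|K].
  apply/idP/idP => [/andP[/andP[/forallP gK /forallP cK] /eqP rK]|gK].
    apply/forallP => b; have := gK b; have /eqP := cK b; rewrite ffunE.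
    have := congr1 (fun f : {ffun rect -> 'I_M.+1} => f b) rK; rewrite !ffunE.
    case: (leqP (kap b.1) b.2) => /= h1.
      by move=> <- _ _; rewrite (ltnNge _ (mu _)) (leq_trans (mk _) h1) /=.
    move=> _ /esym kn; rewrite kn; case: ifP => // _.
    by rewrite (leq_trans h1 (kap_lam _)) => /andP[-> _].
  have /forallP gK' := gK; have v := add_letter_val K gK mk.
  apply/andP; split; last first.
    apply/eqP/ffunP => b; rewrite !ffunE; have := gK' b.
    case: (leqP (kap b.1) b.2) => //= h1.
    rewrite (ltnNge _ (mu _)) (leq_trans (mk _) h1) /= => /eqP kb; exact/val_inj.
  apply/andP; split; apply/forallP => -[r c] /=; have [+ +] := v r c;
    rewrite !letter_at_in.
    have := gK' (r, c) => /= gb ->; have := kap_lam r; have := mk r.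
    case: (ltnP c (mu r)) gb => h1 /=.
      by move=> /eqP -> m1 m2; rewrite (leq_trans h1 m1).
    case: ifP => h2.
      by move=> /andP[-> h3] _ h4 h5; rewrite (leq_trans h2 h4) /= leqW.
    by move=> _ _ _ _; case: (c < lam r)%N; rewrite ?leqnn ?eqxx.
  move=> ->; case: ifP => // _ _; case: ifP => _; first by rewrite ltnn.
  by rewrite leqNgt (leq_trans _ nM).
move=> /andP[/andP[/forallP gK /forallP cK] /eqP rK].
have {}gK : growth n mu kap K.
  apply/forallP => b; have := gK b; have /eqP := cK b; rewrite ffunE.
  have := congr1 (fun f : {ffun rect -> 'I_M.+1} => f b) rK; rewrite !ffunE.
  case: (leqP (kap b.1) b.2) => /= h1.
    by move=> <- _ _; rewrite (ltnNge _ (mu _)) (leq_trans (mk _) h1) /=.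
  move=> _ /esym kn; rewrite kn; case: ifP => // _.
  by rewrite (leq_trans h1 (kap_lam _)) => /andP[-> _].
under eq_bigr do rewrite big_nat_recr //=.
rewrite big_split /=; congr (_ * _).
  apply: eq_bigr => b _; apply: eq_big_nat => i /andP[_ ni].
  by rewrite phi_add_letter_old.
rewrite -(pair_bigA _ (fun (r : 'I_ell) (c : 'I_N) =>
  phi alpha beta x (add_letter K) r c n.+1)) /=.
apply: eq_bigr => r _; rewrite -(phi_add_letter_new K) //.
by rewrite big_mkord.
Qed.

End add_letter.

(** [growth] does not require monotone rows; they are enforced by the weight, since the factor of a
    box at its own letter vanishes when the letter to its right is smaller. *)
Lemma phi_row_mono (n : nat) mu lam K : (n < M)%N -> growth n mu lam K ->
  \prod_(b : rect) \prod_(1 <= i < n.+1) phi alpha beta x K b.1 b.2 i != 0 ->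
  (forall r, mu r <= lam r)%N ->
  forall r c, (letter_at K r c <= letter_at K r c.+1)%N.
Proof.
move=> nM gK W ml r c; case: (ltnP r ell) => re; last by rewrite !letter_at_out ?re.
case: (ltnP c N) => cN; last by rewrite !letter_at_out //; apply/orP; right; lia.
case: (ltnP c.+1 N) => cN1; last first.
  rewrite [X in (_ <= X)%N]letter_at_out ?cN1 ?orbT //.
  by rewrite -[r]/(val (Ordinal re)) -[c]/(val (Ordinal cN)) letter_at_in -ltnS.
move: W => /prodf_neq0/(_ (Ordinal re, Ordinal cN) isT) /=.
rewrite prodf_seq_neq0 => /allP W.
have /forallP := gK => /[dup] /(_ (Ordinal re, Ordinal cN)) + /(_ (Ordinal re,
  Ordinal cN1)) /=.
rewrite -!letter_at_in /=; have := ml r.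
case: (ltnP c (mu r)) => h1 ml' h; first by move/eqP: h => ->.
rewrite (ltnNge _ (mu r)) (leq_trans h1) //=.
case: ifP h => [h2 /andP[k0 kn]|/negbT h2 /eqP kM]; last first.
  have -> : (c.+1 < lam r)%N = false by lia.
  by move=> /eqP ->; rewrite kM.
move=> _; have /W : letter_at K r c \in index_iota 1 n.+1 by rewrite mem_index_iota k0.
rewrite /= /phi ltnn eqxx /act.
case: (leqP (letter_at K r c) (letter_at K r c.+1)) => //= _.
by rewrite mul0r eqxx.
Qed.

Lemma growth_sum_rec (n : nat) mu lam : (n.+1 < M)%N ->
  (forall r, lam r.+1 <= lam r)%N -> (forall r, lam r <= N)%N ->
  (forall r, mu r <= lam r)%N ->
  (forall r, (ell <= r)%N -> lam r = 0%N) ->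
  growth_sum n.+1 mu lam =
  \sum_(kap : config | [forall r : 'I_ell, (mu r <= kap r)%N])
    growth_sum n mu (config_row kap) * step (config_row kap) lam n.+1.
Proof.
move=> nM lam_dec lam_N mu_lam lam_out.
pose W K := \prod_(b : rect) \prod_(1 <= i < n.+2) phi alpha beta x K b.1 b.2 i.
(* In a weakly increasing row the letters at most n occupy an initial segment; its length is the
   first position of a larger letter, or N if there is none. *)
pose kapK K : config := [ffun r : 'I_ell =>
  inord (find (fun c => n < letter_at K r c)%N (iota 0 N))].
pose mono K := [forall b : rect, (letter_at K b.1 b.2 <= letter_at K b.1 b.2.+1)%N].
pose compat (kap : config) K :=
  [forall b : rect, (b.2 < config_row kap b.1)%N == (K b <= n)%N].
have kapE K (r : 'I_ell) : (kapK K r : nat) = find (fun c => n < letter_at K r c)%N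
  (iota 0 N).
  by rewrite ffunE inordK // ltnS (leq_trans (find_size _ _)) // size_iota.
have mono_homo K (r : 'I_ell) : mono K -> {homo letter_at K r : c c' / (c <= c')%N}.
  move=> /forallP mK; apply: homo_leq => [|? ? ?|c]; [exact: leqnn|exact: leq_trans|].
  case: (ltnP c N) => cN; first exact: (mK (r, Ordinal cN)).
  by rewrite !letter_at_out //; apply/orP; right; lia.
have kapP K (r : 'I_ell) c : mono K -> (c < N)%N ->
    (c < kapK K r)%N = (letter_at K r c <= n)%N.
  move=> mK cN; rewrite kapE; apply/idP/idP => [h|].
    by have := before_find 0%N h; rewrite nth_iota // add0n => /negbT; rewrite -leqNgt.
  apply: contraTT; rewrite -leqNgt -ltnNge => h.
  have hs : has (fun c => n < letter_at K r c)%N (iota 0 N).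
    by rewrite has_find size_iota; apply: leq_ltn_trans cN.
  have := nth_find 0%N hs; rewrite nth_iota ?add0n;
    last by rewrite -[X in (_ < X)%N](size_iota 0) -has_find.
  by move=> /leq_trans; apply; apply: mono_homo.
have compatK K (kap : config) : mono K -> compat kap K = (kapK K == kap).
  move=> mK; apply/forallP/eqP => [cK|<- [r c]]; last first.
    by rewrite config_row_in /= kapP // letter_at_in.
  apply/ffunP => r; apply/val_inj => /=.
  have e c : (c < N)%N -> (c < kap r)%N = (c < kapK K r)%N.
    move=> cN; have /eqP := cK (r, Ordinal cN); rewrite /= config_row_in => ->.
    by rewrite kapP // -letter_at_in.
  have := ltn_ord (kap r); have := ltn_ord (kapK K r); rewrite !ltnS => l1 l2.
  case: (ltngtP (kapK K r) (kap r)) => // h.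
    by have := e _ (leq_trans h l2); rewrite h ltnn.
  by have := e _ (leq_trans h l1); rewrite h ltnn.
have W0 K : growth n.+1 mu lam K -> ~~ mono K -> W K = 0.
  move=> gK; apply: contraNeq => WK; apply/forallP => b.
  exact: (phi_row_mono _ _ _ _ nM gK WK).
rewrite /growth_sum.
transitivity (\sum_(K : {ffun rect -> 'I_M.+1} | growth n.+1 mu lam K && mono K) W K).
  rewrite [RHS]big_mkcondr; apply: eq_bigr => K gK; case: ifP => // /negbT mK.
  exact: W0.
have gM K (r c : nat) : growth n.+1 mu lam K -> (r < ell)%N -> (c < N)%N ->
    (if c < mu r then letter_at K r c == 0 else
     if c < lam r then 0 < letter_at K r c <= n.+1 else letter_at K r c == M)%N.
  move=> /forallP gK re cN; have := gK (Ordinal re, Ordinal cN).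
  by rewrite -letter_at_in.
rewrite (partition_big kapK (fun kap : config => [forall r : 'I_ell, (mu r <= kap
  r)%N])) /=; last first.
  move=> K /andP[gK mK]; apply/forallP => r; rewrite leqNgt; apply/negP => h.
  have cN : (kapK K r < N)%N by rewrite (leq_trans h) // (leq_trans (mu_lam _)).
  have := gM K r _ gK (ltn_ord r) cN; rewrite h => /eqP k0.
  by have := kapP K r _ mK cN; rewrite ltnn k0.
apply: eq_bigr => kap /forallP mk.
have mk' r : (mu r <= config_row kap r)%N.
  case: (ltnP r ell) => re; first by have := mk (Ordinal re); rewrite -config_row_in.
  by have := mu_lam r; rewrite lam_out // leqn0 => /eqP ->.
(* If kap is not contained in lam, both sides vanish: the left because boxes outside lam have letter
   M > n, the right by definition of [row_step]. *)
case: (boolP [forall r : 'I_ell, (kap r <= lam r)%N]) => [/forallP kl|]; last first.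
  rewrite negb_forall => /existsP[r]; rewrite -ltnNge => h.
  rewrite [X in _ * X](bigD1 r) //= {1}/row_step config_row_in leqNgt h /= mul0r mulr0.
  rewrite big_pred0 // => K; apply/negP => /andP[/andP[gK mK] /eqP kE].
  have cN : (lam r < N)%N by rewrite (leq_trans h) // -ltnS ltn_ord.
  have := gM K r _ gK (ltn_ord r) cN; rewrite ltnNge mu_lam ltnn /= => /eqP kM.
  by have := kapP K r _ mK cN; rewrite kE h kM => /esym; rewrite leqNgt (ltnW nM).
rewrite -/(growth_sum n mu (config_row kap)) -sum_add_letter //; last first.
  move=> r; case: (ltnP r ell) => re; first by have := kl (Ordinal re);
    rewrite -config_row_in.
  by rewrite config_row_out.
rewrite big_mkcond [RHS]big_mkcond; apply: eq_bigr => K _.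
case: (boolP (growth _ _ _ K)) => //= gK.
case: (boolP (mono K)) => mK /=; first by rewrite -compatK.
by case: ifP => // _; rewrite -/(W K) W0.
Qed.

End one_letter.

(** * Total probability *)

Section total_probability.
Context {d : measure_display} {T : measurableType d} {R : realType}.
Variable P : probability T R.

Definition pr (A : set T) : R := fine (P A).

Lemma prE (A : set T) : measurable A -> P A = (pr A)%:E.
Proof. by move=> mA; rewrite /pr fineK // fin_num_measure. Qed.

Lemma pr_ge0 (A : set T) : 0 <= pr A.
Proof. exact: fine_ge0. Qed.

Lemma pr0 : pr set0 = 0.
Proof. by rewrite /pr measure0. Qed.

Lemma pr_le (A B : set T) : measurable A -> measurable B -> A `<=` B -> pr A <= pr B.
Proof.
move=> mA mB AB; rewrite -lee_fin -!prE //.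
by apply: le_measure; rewrite ?inE.
Qed.

Lemma total_pr_finite (C : finType) (X : T -> C) (A : set T) : measurable A ->
  (forall c, measurable [set t | X t = c]) ->
  pr A = \sum_c pr (A `&` [set t | X t = c]).
Proof.
move=> mA mX; apply: EFin_inj; rewrite -prE // -sumEFin.
rewrite [RHS](eq_bigr (fun c => P (A `&` [set t | X t = c]))); last first.
  by move=> c _; rewrite -prE //; exact: measurableI.
have {1}-> : A = \bigcup_(c in [set: C]) (A `&` [set t | X t = c]).
  apply/seteqP; split => [t At|t [c _ []] //]; by exists (X t).
rewrite measure_fin_bigcup //.
- rewrite (_ : [set: C] = [set` xpredT]); last by apply/seteqP; split.
  rewrite -(@bigfs _ _ _ _ (enum C)) ?enum_uniq ?big_enum //.
  by move=> c _; rewrite mem_enum.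
- exact: finite_finset.
- by move=> c c' _ _ [t [[_ <-] [_ <-]]].
- by move=> c _; exact: measurableI.
Qed.

(** Total probability over the countably many fibres of X. Only attained values are tested, which is
    enough because the other fibres are empty; [pickle] turns the sum over C into a series over the
    naturals. *)
Lemma total_pr_eq (C : countType) (X : T -> C) (A B : set T) (p : R) :
  measurable A -> measurable B -> (forall c, measurable [set t | X t = c]) ->
  (forall t0, pr (A `&` [set t | X t = X t0]) = p * pr (B `&` [set t | X t = X t0])) ->
  pr A = p * pr B.
Proof.
move=> mA mB mX AB.
have fib k : [set t | pickle (X t) = k] = set0 \/
    exists t0, [set t | pickle (X t) = k] = [set t | X t = X t0].
  have [[t0 <-]|no] := pselect (exists t0, pickle (X t0) = k).
    right; exists t0; apply/seteqP; split => [t /=|t /= -> //].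
    exact: (pcan_inj (@pickleK C)).
  by left; apply/seteqP; split => // t /= tk; apply: no; exists t.
have mfib k : measurable [set t | pickle (X t) = k].
  by have [->|[t0 ->]] := fib k.
have dec E : measurable E -> P E = (\sum_(k <oo) P (E `&` [set t | pickle (X t) =
  k]))%E.
  move=> mE; rewrite -[in LHS](_ : \bigcup_k (E `&` [set t | pickle (X t) = k]) = E).
    rewrite measure_bigcup //.
    - by apply: eq_eseriesl => k; apply/idP/mem_set.
    - by move=> k _; exact: measurableI.
    - by move=> k k' _ _ [t [[_ /= <-] [_ /= <-]]].
  by apply/seteqP; split => [t [k _ []] //|t Et]; exists (pickle (X t)).
apply: EFin_inj; rewrite EFinM -!prE // (dec A) // (dec B) // -nneseriesZl //.
apply: eq_eseriesr => k _.
rewrite !prE; [|exact: measurableI..]; rewrite -EFinM; congr EFin.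
by have [->|[t0 ->]] := fib k; rewrite ?setI0 ?pr0 ?mulr0 // AB.
Qed.

End total_probability.

(** * Joint law of independent jumps, with point values and tails *)

Section product_law.
Import numFieldNormedType.Exports.
Context {d : measure_display} {T : measurableType d} {R : realType}.
Variables (P : probability T R) (ell : nat) (W : 'I_ell -> T -> nat) (H : set T).
Variables (f tl : 'I_ell -> nat -> R).
Hypotheses (mH : measurable H) (mW : forall j a, measurable [set t | W j t = a]).
Hypotheses (f_ge0 : forall j u, 0 <= f j u) (tl_ge0 : forall j u, 0 <= tl j u).
Hypothesis f_sum : forall j N, \sum_(0 <= u < N) f j u = 1 - tl j N.
Hypothesis atoms : forall u : 'I_ell -> nat,
  pr P ([set t | forall j, W j t = u j] `&` H) = (\prod_j f j (u j)) * pr P H.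

Let mWP (Q : 'I_ell -> pred nat) : measurable [set t | forall j, Q j (W j t)].
Proof.
rewrite (_ : [set _ | _] = \bigcap_(j in [set: 'I_ell]) [set t | Q j (W j t)]);
  last first.
  by apply/seteqP; split => [t h j _|t h j] //; exact: h.
apply: fin_bigcap_measurable; first exact: finite_finset.
move=> j _; rewrite (_ : [set t | _] =
  \bigcup_(a in [set a | Q j a]) [set t | W j t = a]); last first.
  by apply/seteqP; split => [t h|t [a h /= ->] //]; exists (W j t).
exact: bigcup_measurable.
Qed.

Let box_pr (Q : 'I_ell -> pred nat) (N : nat) :
  pr P ([set t | forall j, Q j (W j t) && (W j t < N.+1)%N] `&` H) =
  (\prod_j \sum_(u < N.+1 | Q j u) f j u) * pr P H.
Proof.
set A := _ `&` H.
have mA : measurable A by apply: measurableI => //;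
  exact: (mWP (fun j u => Q j u && (u < N.+1)%N)).
pose X t : {ffun 'I_ell -> 'I_N.+1} := [ffun j => inord (W j t)].
rewrite (total_pr_finite P _ X) //; last first.
  move=> c; rewrite (_ : [set t | _] =
     [set t | forall j, (inord (W j t) == c j :> 'I_N.+1)]).
    exact: (mWP (fun j u => inord u == c j :> 'I_N.+1)).
  apply/seteqP; split => [t /= <- j|t /= h]; first by rewrite ffunE.
  by apply/ffunP => j; rewrite ffunE; apply/eqP.
rewrite bigA_distr_big_dep mulr_suml [RHS]big_mkcond /=; apply: eq_bigr => c _.
case: ifP => [/familyP cQ|/negP cQ].
  rewrite -(atoms (fun j => c j)); congr (pr P _).
  apply/seteqP; split => [t [[h Ht] /= Xc]|t [/= h Ht]].
    split => // j; have /andP[_ wN] := h j.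
    by have := congr1 (fun g : {ffun 'I_ell -> 'I_N.+1} => g j : nat) Xc;
      rewrite ffunE inordK.
  split; last by apply/ffunP => j; rewrite ffunE h inord_val.
  by split => // j; rewrite h ltn_ord andbT; exact: cQ.
rewrite (_ : _ `&` _ = set0) ?pr0 //; apply/seteqP; split => // t [[h Ht] /= Xc].
apply: cQ; apply/familyP => j; have /andP[Qw wN] := h j.
by have := congr1 (fun g : {ffun 'I_ell -> 'I_N.+1} => g j : nat) Xc;
  rewrite ffunE inordK // -topredE /= => <-.
Qed.

Let box_cvg (Q : 'I_ell -> pred nat) :
  pr P ([set t | forall j, Q j (W j t) && (W j t < N.+1)%N] `&` H) @[N --> \oo] -->
  pr P ([set t | forall j, Q j (W j t)] `&` H).
Proof.
pose F N := [set t | forall j, Q j (W j t) && (W j t < N.+1)%N] `&` H.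
have mF N : measurable (F N).
  by apply: measurableI => //; exact: (mWP (fun j u => Q j u && (u < N.+1)%N)).
have UF : \bigcup_N F N = [set t | forall j, Q j (W j t)] `&` H.
  apply/seteqP; split => [t [N _ [h Ht]]|t [/= h Ht]].
    by split => // j; have /andP[] := h j.
  exists (\max_j W j t)%N => //; split => // j; rewrite h ltnS.
  exact: (leq_bigmax j).
have := @nondecreasing_cvg_mu _ _ _ P F mF.
rewrite UF => /(_ (measurableI _ _ (mWP Q) mH)) cv.
apply: fine_cvg; rewrite -/(pr P _) -prE; last by apply: measurableI => //; exact: mWP.
apply: cv => N N' NN'; apply/subsetPset => t [h Ht]; split => // j.
by have /andP[-> wN] := h j; rewrite (leq_trans wN).
Qed.

Let cvg_eventually (N0 : nat) (u v : nat -> R) (l : R) :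
  (forall N, (N0 <= N)%N -> v N = u N) -> v @ \oo --> l -> u @ \oo --> l.
Proof.
move=> uv vl; apply: (cvg_trans _ vl); apply: near_eq_cvg.
by exists N0 => // N /= /uv.
Qed.

Let prod_cvg (u : 'I_ell -> nat -> R) (l : 'I_ell -> R) :
  (forall j, u j N @[N --> \oo] --> l j) -> \prod_j u j N @[N --> \oo] --> \prod_j l j.
Proof. by move=> ul; apply: cvg_big => //; exact: mul_continuous. Qed.

Let sum_ord (j : 'I_ell) N : \sum_(u < N) f j u = 1 - tl j N.
Proof. by rewrite -f_sum big_mkord. Qed.

(* The limit of the boxes has full mass only if no law loses mass at infinity. *)
Let tl_cvg0 : pr P H != 0 -> forall j, tl j N.+1 @[N --> \oo] --> (0 : R).
Proof.
move=> H0 j.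
have tl1 i N : 0 <= 1 - tl i N <= 1.
  by rewrite -f_sum sumr_ge0 //= f_sum lerBlDr lerDl.
have cv : \prod_i (1 - tl i N.+1) @[N --> \oo] --> (1 : R).
  have := box_cvg (fun _ _ => true).
  rewrite (_ : [set t | _] `&` H = H); last by apply/seteqP; split => [t []|t].
  move=> cH; have := cvgM cH (cvg_cst (pr P H)^-1); rewrite mulfV // => {}cH.
  apply: (cvg_eventually 0 _ _ _ _ (cH _ _)) => N _ /=;
    rewrite (box_pr (fun _ _ => true)) mulfK //.
  by apply: eq_bigr => i _; rewrite sum_ord.
have cv1 : 1 - tl j N.+1 @[N --> \oo] --> (1 : R).
  (* Each factor lies between the whole product, which tends to 1, and 1. *)
  apply: squeeze_cvgr cv (cvg_cst _); near=> N.
  have /andP[t0 t1] := tl1 j N.+1; rewrite t1 andbT (bigD1 j) //= ler_piMr //.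
  by apply: prodr_ile1 => i _; exact: tl1.
have := cvgB (cvg_cst (1 : R)) cv1; rewrite subrr => {}cv1; 
by apply: (cvg_eventually 0 _ _ _ _ (cv1 _ _)) => N _ /=; rewrite subKr.
Unshelve. all: by end_near.
Qed.

(** Cut off by N, the event is a finite union of atoms and has a product law. As N grows these
    cut-offs exhaust the event, and a coordinate bounded below contributes [tl j (a j) - tl j N.+1],
    whose second term tends to 0 by [tl_cvg0]. *)
Lemma product_law (e : 'I_ell -> bool) (a : 'I_ell -> nat) :
  pr P ([set t | forall j, if e j then W j t == a j else (a j <= W j t)%N] `&` H) =
  (\prod_j (if e j then f j (a j) else tl j (a j))) * pr P H.
Proof.
have [H0|H0] := eqVneq (pr P H) 0.
  rewrite H0 mulr0; apply/eqP; rewrite eq_le pr_ge0 andbT -H0; apply: pr_le => //.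
  apply: measurableI => //;
    exact: (mWP (fun j u => if e j then u == a j else (a j <= u)%N)).
pose Q j u := if e j then u == a j else (a j <= u)%N.
apply: (cvg_unique _ (box_cvg Q)) => //.
rewrite (_ : (fun N => _) = (fun N => (\prod_j \sum_(u < N.+1 | Q j u) f j u) * pr P
  H)).
  apply: cvgM; last exact: cvg_cst.
  apply: prod_cvg => j; rewrite /Q; case: (e j).
    apply: cvg_near_cst; exists (a j) => // N /= aN.
    have aN1 : (a j < N.+1)%N by [].
    by rewrite (big_pred1 (Ordinal aN1)).
  have := cvgB (cvg_cst (tl j (a j))) (tl_cvg0 H0 j); rewrite subr0 => cv.
  apply: (cvg_eventually (a j) _ _ _ _ (cv _ _)) => N /= aN.
  have := sum_ord j N.+1; rewrite (bigID (fun u : 'I_N.+1 => (a j <= u)%N)) /=.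
  rewrite (_ : \sum_(i < N.+1 | ~~ (a j <= i)%N) f j i = 1 - tl j (a j)).
    move=> h; suff : tl j (a j) - tl j N.+1 = \sum_(i < N.+1 | (a j <= i)%N) f j i by
      [].
    by lra.
  rewrite -sum_ord (big_ord_widen _ (f j) (leq_trans aN (leqnSn N))).
  by apply: eq_bigl => u; rewrite -ltnNge.
by apply/funext => N; rewrite box_pr.
Qed.

End product_law.

(** Since 1 - (alpha + pi) x / (1 + alpha x) = (1 - pi x) / (1 + alpha x), each mass is the
    difference of two consecutive tail products. *)
Lemma jump_law_sum {R : realType} (alpha : nat -> R) (pj xi : R) (m N : nat) :
  (forall k, 1 + alpha k * xi != 0) ->
  \sum_(0 <= u < N) jump_law alpha pj xi m u =
  1 - \prod_(m <= k < m + N) ((alpha k + pj) * xi / (1 + alpha k * xi)).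
Proof.
move=> a0; elim: N => [|N IH]; first by rewrite !big_geq ?addn0 // subrr.
rewrite big_nat_recr //= IH addnS big_nat_recr ?leq_addr //= /jump_law.
set p := \prod_(_ <= _ < _) _; have := a0 (m + N)%N; set q := alpha _ => q0.
by field.
Qed.

(** * Transition probabilities of the particle system *)

Section markov.
Context {d : measure_display} {T : measurableType d} {R : realType}.
Variables (P : probability T R) (ell : nat) (x pi_ alpha : nat -> R).
Variables (G w : nat -> nat -> T -> nat).
Hypothesis pi_x : forall i j, (1 <= i)%N -> (1 <= j <= ell)%N -> 0 < pi_ j * x i < 1.
Hypothesis alpha_x : forall i k, (1 <= i)%N -> -1 < alpha k * x i.
Hypothesis alpha_pi : forall j k, (1 <= j <= ell)%N -> 0 <= alpha k + pi_ j.
Hypothesis alpha0 : alpha 0%N = 0.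
Hypothesis system : geometric_blocking_system P ell x pi_ alpha G w.
Implicit Types (s kap lam mu : nat -> nat).

Definition at_rows (i : nat) s : set T := [set t | forall r : 'I_ell, G r.+1 i t = s r].

Definition jump_tail (pj xi : R) (m u : nat) : R :=
  \prod_(m <= k < m + u) ((alpha k + pj) * xi / (1 + alpha k * xi)).

(** A particle is blocked by the old position of its predecessor, not by the new one; given kap, the
    condition on row r thus involves the jump of that row only. *)
Definition row_prob kap lam (i r : nat) : R :=
  if (kap r <= lam r)%N && ((r == 0%N) || (lam r <= kap r.-1)%N) then
    if (r == 0%N) || (lam r < kap r.-1)%N
    then jump_law alpha (pi_ r.+1) (x i) (kap r) (lam r - kap r)
    else jump_tail (pi_ r.+1) (x i) (kap r) (lam r - kap r)
  else 0.

Definition transition kap lam (i : nat) : R := \prod_(r < ell) row_prob kap lam i r.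

Lemma positions_ordered (i j : nat) (t : T) :
  (1 <= j < ell)%N -> (G j.+1 i t <= G j i t)%N.
Proof.
elim: i j => [|i IH] j jl; first exact: (initially_ordered system).
have jl1 : (1 <= j.+1 <= ell)%N by lia.
have jl2 : (1 <= j <= ell)%N by lia.
rewrite (update system _ _ jl1) /= gtn_eqF; last by lia.
apply: leq_trans (geq_minr _ _) _ => /=; rewrite (update system _ _ jl2).
case: eqP => [_|j1]; first exact: leq_addr.
rewrite leq_min leq_addr /=; have := IH j.-1; rewrite prednK; last by lia.
by apply; lia.
Qed.

Lemma positions_le (i j : nat) (t : T) : (1 <= j <= ell)%N -> (G j i t <= G j i.+1 t)%N.
Proof.
move=> jl; rewrite (update system _ _ jl); case: eqP => [_|j1]; first exact: leq_addr.
rewrite leq_min leq_addr /=; have := @positions_ordered i j.-1 t; rewrite prednK;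
  last by lia.
by apply; lia.
Qed.

Lemma measurable_position (i j a : nat) : (1 <= j <= ell)%N ->
  measurable [set t | G j i t = a].
Proof.
move=> jl; have mG := position_measurable system i jl.
by have := mG measurableT [set a] I; rewrite setTI.
Qed.

Lemma measurable_jump (i j a : nat) : (1 <= j <= ell)%N -> (1 <= i)%N ->
  measurable [set t | w j i t = a].
Proof.
move=> jl i0; have mw := jump_measurable system jl i0.
by have := mw measurableT [set a] I; rewrite setTI.
Qed.

Lemma measurable_at_rows (i : nat) s : measurable (at_rows i s).
Proof.
rewrite (_ : at_rows i s = \bigcap_(r in [set: 'I_ell]) [set t | G r.+1 i t = s r]).
  apply: fin_bigcap_measurable; first exact: finite_finset.
  by move=> r _; apply: measurable_position; rewrite /= ltn_ord.
by apply/seteqP; split => [t h r _|t h r] //; exact: h.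
Qed.

Lemma measurable_history (i : nat) (g v : nat -> nat -> nat) :
  measurable (history ell G w i g v).
Proof.
pose F (jk : 'I_ell * 'I_i.+1) := [set t | G jk.1.+1 jk.2 t = g jk.1.+1 jk.2].
pose F' (jk : 'I_ell * 'I_i) := [set t | w jk.1.+1 jk.2.+1 t = v jk.1.+1 jk.2.+1].
rewrite (_ : history ell G w i g v = (\bigcap_(jk in setT) F jk) `&` (\bigcap_(jk in
  setT) F' jk)).
  apply: measurableI; apply: fin_bigcap_measurable; try exact: finite_finset.
    by move=> [r k] _; apply: measurable_position; rewrite /= ltn_ord.
  by move=> [r k] _; apply: measurable_jump; rewrite //= ltn_ord.
apply/seteqP; split => t [h1 h2]; split.
- by move=> [r k] _; apply: h1; rewrite /= ?ltn_ord // -ltnS ltn_ord.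
- by move=> [r k] _; apply: h2; rewrite /= ltn_ord.
- move=> [//|j] k /andP[_ jl] ki;
  exact: (h1 (Ordinal jl, Ordinal (ki : (k < i.+1)%N)) I).
- move=> [//|j] [//|k] /andP[_ jl] /andP[_ ki]; exact: (h2 (Ordinal jl, Ordinal ki) I).
Qed.

Let denom_gt0 (i k : nat) : (1 <= i)%N -> 0 < 1 + alpha k * x i.
Proof. by move=> i0; have := alpha_x _ k i0; lra. Qed.

Let x_gt0 (i j : nat) : (1 <= i)%N -> (1 <= j <= ell)%N -> 0 < x i.
Proof.
move=> i0 jl; have /andP[px _] := pi_x _ _ i0 jl.
(* At k = 0, where alpha_0 = 0, the hypothesis gives pi_j >= 0; with pi_j x_i > 0 this yields the
   sign of x_i. *)
have := alpha_pi _ 0%N jl; rewrite alpha0 add0r => p0.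
have pg : 0 < pi_ j.
  by rewrite lt_neqAle p0 andbT eq_sym; apply/eqP => pj; move: px;
    rewrite pj mul0r ltxx.
by move: px; rewrite pmulr_rgt0.
Qed.

Let jump_tail_ge0 (i j m u : nat) : (1 <= i)%N -> (1 <= j <= ell)%N ->
  0 <= jump_tail (pi_ j) (x i) m u.
Proof.
move=> i0 jl; apply: prodr_ge0 => k _; apply: divr_ge0; last exact/ltW/denom_gt0.
by apply: mulr_ge0; [exact: alpha_pi|exact/ltW/(x_gt0 _ _ i0 jl)].
Qed.

Lemma history_step (i : nat) (g v : nat -> nat -> nat) lam :
  0 < pr P (history ell G w i g v) ->
  pr P (at_rows i.+1 lam `&` history ell G w i g v) =
  transition (fun r => g r.+1 i) lam i.+1 * pr P (history ell G w i g v).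
Proof.
set H := history _ _ _ _ _ _ => H0; have mH : measurable H by exact: measurable_history.
pose kap r := g r.+1 i.
have HG t : H t -> forall r, (r < ell)%N -> G r.+1 i t = kap r.
  by move=> [h _] r rl; apply: h => //; rewrite /= rl.
have kap_dec r : (r.+1 < ell)%N -> (kap r.+1 <= kap r)%N.
  have [H00|/set0P[t Ht]] := eqVneq H set0; first by move: H0; rewrite H00 pr0 ltxx.
  by move=> rl; rewrite -!(HG t) //; [apply: positions_ordered|lia].
have upd t : H t -> forall r, (r < ell)%N -> G r.+1 i.+1 t =
    if r == 0%N then (kap r + w r.+1 i.+1 t)%N else minn (kap r + w r.+1 i.+1 t) (kap
      r.-1).
  move=> Ht r rl; rewrite (update system); last by rewrite /= rl.
  rewrite eqSS (HG t Ht) //=; case: r rl => //= r rl; rewrite (HG t Ht) //; lia.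
have [/forallP adm|] := boolP [forall r : 'I_ell, (kap r <= lam r)%N &&
    ((r == 0%N :> nat) || (lam r <= kap r.-1)%N)]; last first.
  rewrite negb_forall => /existsP[r nadm].
  rewrite /transition (bigD1 r) //= {1}/row_prob (negbTE nadm) !mul0r.
  rewrite (_ : _ `&` _ = set0) ?pr0 //; apply/seteqP; split => // t [/(_ r) + Ht].
  rewrite (upd t Ht) //; have := ltn_ord r;
    case: (nat_of_ord r) nadm => [|r'] /= nadm rl.
    by move=> h; move: nadm; rewrite -h leq_addr.
  move=> h; have := kap_dec r' rl; move: nadm; rewrite -h; lia.
pose e (r : 'I_ell) := (r == 0%N :> nat) || (lam r < kap r.-1)%N.
pose a (r : 'I_ell) := (lam r - kap r)%N.
pose W (r : 'I_ell) := w r.+1 i.+1.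
pose f (r : 'I_ell) u := jump_law alpha (pi_ r.+1) (x i.+1) (kap r) u.
pose tl (r : 'I_ell) u := jump_tail (pi_ r.+1) (x i.+1) (kap r) u.
have jl (r : 'I_ell) : (1 <= r.+1 <= ell)%N by rewrite /= ltn_ord.
(* On H the update rule decouples: a free particle must jump by exactly the difference of positions,
   a blocked one by at least that much. *)
rewrite (_ : _ `&` H = [set t | forall r, if e r then W r t == a r else (a r <= W r
  t)%N] `&` H); last first.
  apply/seteqP; split => t [h Ht]; split => // r; have := h r; have := adm r;
    rewrite (upd t Ht) // /e /a /W; case: (nat_of_ord r) (ltn_ord r) => [|r'] rl /=.
  - by rewrite andbT => hl hw; apply/eqP; lia.
  - by move=> hl hw; case: ltnP => hh; lia.
  - by rewrite andbT => hl /eqP hw; lia.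
  - by move=> hl; case: ltnP => hh hw; lia.
rewrite (product_law P ell W H f tl) //.
- congr (_ * _); apply: eq_bigr => r _; rewrite /row_prob adm /e /f /tl /a.
  by [].
- by move=> r b; apply: measurable_jump; rewrite // jl.
- move=> r u; rewrite /f /jump_law mulr_ge0 //; last exact: jump_tail_ge0.
  rewrite divr_ge0 //; last by rewrite ltW ?denom_gt0.
  by have /andP[_ h] := pi_x _ _ (ltn0Sn i) (jl r); lra.
- by move=> r u; exact: jump_tail_ge0.
- by move=> r N; rewrite /f jump_law_sum // => k; rewrite gt_eqF ?denom_gt0.
- move=> u; pose u' j := if insub j.-1 is Some r then u r else 0%N.
  have HP : (0 < P H)%E by rewrite prE // lte_fin.
  have := jump_distribution system u' HP; rewrite /cond_prob -/(pr P _) -/(pr P H).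
  rewrite (_ : [set t | forall j, _] = [set t | forall r, W r t = u r]); last first.
    apply/seteqP; split => [t h r|t h j /andP[j0 jle]].
      by rewrite /W h /u' /= ?valK //; exact: jl.
    have rl : (j.-1 < ell)%N by rewrite prednK.
    by have := h (Ordinal rl); rewrite /W /u' /= insubT prednK.
  move=> hh; rewrite -[LHS](@mulfVK _ (pr P H)) ?gt_eqF // hh.
  rewrite big_add1 big_mkord; congr (_ * _); apply: eq_bigr => r _.
  by rewrite /f /u' /= valK.
Qed.

(** The law of the jumps is prescribed given a complete history. There are countably many histories,
    and the transition factor depends only on the positions at time i, so it is the same for all
    those ending in kap. *)
Lemma markov_step (i : nat) kap lam mu :
  pr P (at_rows i.+1 lam `&` (at_rows i kap `&` at_rows 0 mu)) =
  transition kap lam i.+1 * pr P (at_rows i kap `&` at_rows 0 mu).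
Proof.
pose X (t : T) : {ffun 'I_ell * 'I_i.+1 -> nat} * {ffun 'I_ell * 'I_i -> nat} :=
  ([ffun jk : 'I_ell * 'I_i.+1 => G jk.1.+1 jk.2 t],
   [ffun jk : 'I_ell * 'I_i => w jk.1.+1 jk.2.+1 t]).
have XE t0 : [set t | X t = X t0] =
    history ell G w i (fun j k => G j k t0) (fun j k => w j k t0).
  apply/seteqP; split => [t /= [/ffunP h1 /ffunP h2]|t [h1 h2] /=].
    split => [[//|j] k /andP[_ jl] ki|[//|j] [//|k] /andP[_ jl] /andP[_ ki]].
      by have := h1 (Ordinal jl, Ordinal (ki : (k < i.+1)%N)); rewrite !ffunE.
    by have := h2 (Ordinal jl, Ordinal ki); rewrite !ffunE.
  congr pair; apply/ffunP => -[r k]; rewrite !ffunE /=.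
    by apply: h1; rewrite /= ?ltn_ord // -ltnS ltn_ord.
  by apply: h2; rewrite /= ltn_ord.
have mrows := measurable_at_rows.
have mB : measurable (at_rows i kap `&` at_rows 0 mu) by exact: measurableI.
apply: (total_pr_eq P _ X) => //; first exact: measurableI.
  move=> c; have [[t0 <-]|no] := pselect (exists t0, X t0 = c).
    by rewrite XE; exact: measurable_history.
  rewrite (_ : [set t | _] = set0) //.
  by apply/seteqP; split => // t /= tc; apply: no; exists t.
move=> t0; rewrite XE; set H := history _ _ _ _ _ _.
have mH : measurable H by exact: measurable_history.
have Ht0 : H t0 by [].
have HG t : H t -> forall (r : 'I_ell) k, (k <= i)%N -> G r.+1 k t = G r.+1 k t0.
  by move=> [h _] r k ki; apply: h => //; rewrite /= ltn_ord.
have [[B1 B2]|nB] := pselect ((at_rows i kap `&` at_rows 0 mu) t0); last first.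
  have -> : at_rows i kap `&` at_rows 0 mu `&` H = set0.
    apply/seteqP; split => // t [[h1 h2] Ht]; apply: nB; split => r.
      by rewrite -(HG t Ht) // h1.
    by rewrite -(HG t Ht) // h2.
  rewrite pr0 mulr0 (_ : _ `&` H = set0) ?pr0 //.
  apply/seteqP; split => // t [[_ [h1 h2]] Ht]; apply: nB; split => r.
    by rewrite -(HG t Ht) // h1.
  by rewrite -(HG t Ht) // h2.
have -> : at_rows i kap `&` at_rows 0 mu `&` H = H.
  apply/seteqP; split => [t []//|t Ht]; split => //; split => r.
    by rewrite (HG t Ht) // B1.
  by rewrite (HG t Ht) // B2.
have -> : at_rows i.+1 lam `&` (at_rows i kap `&` at_rows 0 mu) `&` H = at_rows i.+1
  lam `&` H.
  apply/seteqP; split => [t [[]]//|t [h Ht]]; split => //; split => //; split => r.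
    by rewrite (HG t Ht) // B1.
  by rewrite (HG t Ht) // B2.
have [H0|H0] := eqVneq (pr P H) 0.
  rewrite H0 mulr0; apply/eqP; rewrite eq_le pr_ge0 andbT -H0.
  by apply: pr_le => //; exact: measurableI.
rewrite history_step; last by rewrite lt_neqAle eq_sym H0 pr_ge0.
congr (_ * _); rewrite /transition; apply: eq_bigr => r _.
have Bk (k : nat) : (k < ell)%N -> G k.+1 i t0 = kap k by move=> kl;
  exact: (B1 (Ordinal kl)).
rewrite /row_prob Bk //; case: (nat_of_ord r) (ltn_ord r) => //= k kl.
by rewrite Bk // ltnW.
Qed.

(** Positions never decrease, so before reaching lam the particles stay within the bound N, and
    finitely many intermediate configurations suffice. *)
Lemma chapman_kolmogorov (N i : nat) lam mu : (forall r : 'I_ell, (lam r <= N)%N) ->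
  pr P (at_rows i.+1 lam `&` at_rows 0 mu) =
  \sum_(kap : {ffun 'I_ell -> 'I_N.+1})
    pr P (at_rows i (config_row kap) `&` at_rows 0 mu) *
    transition (config_row kap) lam i.+1.
Proof.
move=> lamN; pose X (t : T) : {ffun 'I_ell -> 'I_N.+1} := [ffun r : 'I_ell => inord
  (G r.+1 i t)].
have mrows := measurable_at_rows.
rewrite (total_pr_finite P _ X); first last.
- move=> c; rewrite (_ : [set t | _] = \bigcap_(r in [set: 'I_ell])
     \bigcup_(a in [set a | inord a = c r :> 'I_N.+1]) [set t | G r.+1 i t = a]).
    apply: fin_bigcap_measurable; first exact: finite_finset.
    move=> r _; apply: bigcup_measurable => a _.
    by apply: measurable_position; rewrite /= ltn_ord.
  apply/seteqP; split => [t /= <- r _|t h].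
    by exists (G r.+1 i t) => //=; rewrite ffunE.
  by apply/ffunP => r; rewrite ffunE; have [a /= <- ->] := h r I.
- exact: measurableI.
apply: eq_bigr => c _; rewrite mulrC -markov_step; congr (pr P _).
apply/seteqP; split => t.
  move=> [[h1 h2] /= Xc]; split => //; split => // r.
  rewrite config_row_in -Xc ffunE inordK // ltnS.
  apply: leq_trans (lamN r); rewrite -h1; apply: positions_le.
  by rewrite /= ltn_ord.
move=> [h1 [h2 h3]]; split; first by split.
by apply/ffunP => r; rewrite ffunE h2 config_row_in inord_val.
Qed.

End markov.

(** * Comparison of the two recursions *)

Section comparison.
Context {R : realType} {ell : nat} (x pi_ alpha beta : nat -> R).
Hypothesis alpha0 : alpha 0%N = 0.
Hypothesis pi_out : forall j, (ell < j)%N -> pi_ j = 0.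
Hypothesis beta_pi : forall j, (1 <= j)%N -> beta j = pi_ j.+1.
Implicit Types (kap lam mu : nat -> nat).

Definition row_power kap lam : R :=
  \prod_(r < ell) \prod_(kap r <= c < lam r) (alpha c + pi_ r.+1).

Lemma row_power_trans mu kap lam :
  (forall r, (r < ell)%N -> (mu r <= kap r <= lam r)%N) ->
  row_power mu kap * row_power kap lam = row_power mu lam.
Proof.
move=> mkl; rewrite /row_power -big_split /=; apply: eq_bigr => r _.
by have /andP[mk kl] := mkl r (ltn_ord r); rewrite -big_cat_nat.
Qed.

(** Replacing f(c) by f(c + 1) in the denominators telescopes to one quotient. This converts between
    the columns of boxes and the sites of particles. *)
Lemma prod_shift (f : nat -> R) (m n : nat) (y : R) :
  (forall k, f k != 0) -> (m <= n)%N ->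
  \prod_(m <= c < n) (y / f c.+1) = (\prod_(m <= c < n) (y / f c)) * (f m / f n).
Proof.
move=> f0; elim: n => [|n IH]; first by rewrite leqn0 => /eqP ->;
  rewrite !big_geq // mul1r divff.
rewrite leq_eqVlt => /orP[/eqP <-|mn]; first by rewrite !big_geq // mul1r divff.
rewrite !big_nat_recr //= IH //; have := f0 n; have := f0 n.+1;
  set p := \prod_(_ <= _ < _) _.
by move=> fn1 fn; field; rewrite fn fn1.
Qed.

Section one_step.
Variables (i : nat) (kap lam : nat -> nat).
Hypothesis denom_neq0 : forall k, 1 + alpha k * x i != 0.
Hypothesis lam_out : forall r, (ell <= r)%N -> lam r = 0%N.

Let den k := 1 + alpha k * x i.

Let free_factor r : R :=
  if (r == 0%N) || (lam r < kap r.-1)%N then 1 - pi_ r.+1 * x i else den (lam r).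

Lemma step_neq0_interlace : step (ell := ell) alpha beta x kap lam i != 0 ->
  forall r, (r < ell)%N -> (kap r <= lam r)%N && (lam r.+1 <= kap r)%N.
Proof.
move=> /prodf_neq0 h r rl; have := h (Ordinal rl) isT.
by rewrite /row_step /=; case: ifP => //; rewrite eqxx.
Qed.

(** Apart from the power of alpha + pi, both sides have the factor [base r] in row r. What remains
    is [free_factor r] for the particles but [free_factor r.+1] for the growth, so the two products
    differ only in their end factors. *)
Lemma transition_step :
  transition ell x pi_ alpha kap lam i =
  (1 - pi_ 1%N * x i) * (row_power kap lam * step (ell := ell) alpha beta x kap lam i).
Proof.
have [/forallP adm|] := boolP [forall r : 'I_ell, (kap r <= lam r)%N &&
    ((r == 0%N :> nat) || (lam r <= kap r.-1)%N)]; last first.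
  rewrite negb_forall => /existsP[r nadm].
  rewrite /transition (bigD1 r) //= {1}/row_prob (negbTE nadm) mul0r.
  suff -> : step (ell := ell) alpha beta x kap lam i = 0 by rewrite !mulr0.
  apply: contraNeq nadm => /step_neq0_interlace st.
  have /andP[-> _] := st r (ltn_ord r); rewrite /=.
  case: (nat_of_ord r) (ltn_ord r) => //= r' rl.
  by have /andP[_ ->] := st r' (ltnW rl).
have adm' r : (r < ell)%N -> (kap r <= lam r)%N && (lam r.+1 <= kap r)%N.
  move=> rl; have /andP[-> _] := adm (Ordinal rl); rewrite /=.
  case: (ltnP r.+1 ell) => rl1; last by rewrite lam_out.
  by have /andP[_] := adm (Ordinal rl1).
pose base r := (\prod_(kap r <= c < lam r) (x i / den c)) / den (lam r).
have probE (r : 'I_ell) : row_prob x pi_ alpha kap lam i r =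
    (\prod_(kap r <= c < lam r) (alpha c + pi_ r.+1)) * base r * free_factor r.
  have /andP[kl _] := adm' r (ltn_ord r); rewrite /row_prob adm /base /free_factor.
  have tailE : jump_tail alpha (pi_ r.+1) (x i) (kap r) (lam r - kap r) =
      (\prod_(kap r <= c < lam r) (alpha c + pi_ r.+1)) *
      \prod_(kap r <= c < lam r) (x i / den c).
    by rewrite /jump_tail subnKC // -big_split /=; apply: eq_bigr => c _; rewrite mulrA.
  case: ifP => _; last first.
    by rewrite tailE -!mulrA mulVf ?mulr1 //; exact: denom_neq0.
  rewrite /jump_law -/(jump_tail _ _ _ _ _) tailE subnKC // -/(den (lam r)).
  set A := \prod_(_ <= _ < _) _; set B := \prod_(_ <= _ < _) _.
  by have d0 : den (lam r) != 0 := denom_neq0 _; field.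
(* The last old box of row r is active exactly when the next particle is not blocked. If it is
   blocked, [lam r.+1 = kap r] and the quotient from [prod_shift] supplies its [den]. *)
have stepE (r : 'I_ell) : row_step alpha beta x kap lam i r = base r * free_factor r.+1.
  rewrite /row_step adm' // /base /free_factor /=.
  have /andP[kl lk] := adm' r (ltn_ord r).
  rewrite (prod_shift den) //; case: ltnP => h.
    rewrite /box_step beta_pi // prednK ?(leq_ltn_trans _ h) // -/(den (kap r)).
    have := denom_neq0 (kap r); have := denom_neq0 (lam r); rewrite -!/(den _).
    by move=> d1 d2; field; rewrite d1 d2.
  have -> : lam r.+1 = kap r by apply/eqP; rewrite eqn_leq lk.
  by rewrite mulr1 -mulrA [_ / den _]mulrC.
have shift : \prod_(r < ell) free_factor r =
    (1 - pi_ 1%N * x i) * \prod_(r < ell) free_factor r.+1.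
  transitivity (\prod_(r < ell.+1) free_factor r); last by rewrite big_ord_recl.
  (* The bottom factor is 1 in both cases: [pi_ ell.+1 = 0] if the row counts as free, and
     [lam ell = 0] with alpha_0 = 0 if it counts as blocked. *)
  rewrite big_ord_recr /=; suff -> : free_factor ell = 1 by rewrite mulr1.
  rewrite /free_factor pi_out // mul0r subr0 lam_out // /den alpha0 mul0r addr0.
  by case: ifP.
rewrite /transition /row_power /step (eq_bigr _ (fun r _ => probE r)).
rewrite (eq_bigr _ (fun r _ => stepE r)) !big_split /= shift.
by ring.
Qed.

End one_step.
End comparison.

(** * Growth sums as joint probabilities *)

Section growth_probability.
Context {d : measure_display} {T : measurableType d} {R : realType}.
Variables (P : probability T R) (ell N M : nat) (x pi_ alpha beta : nat -> R).
Variables (G w : nat -> nat -> T -> nat).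
Hypothesis alpha0 : alpha 0%N = 0.
Hypothesis pi_out : forall j, (ell < j)%N -> pi_ j = 0.
Hypothesis pi_x : forall i j, (1 <= i)%N -> (1 <= j <= ell)%N -> 0 < pi_ j * x i < 1.
Hypothesis alpha_x : forall i k, (1 <= i)%N -> -1 < alpha k * x i.
Hypothesis alpha_pi : forall j k, (1 <= j <= ell)%N -> 0 <= alpha k + pi_ j.
Hypothesis beta_pi : forall j, (1 <= j)%N -> beta j = pi_ j.+1.
Hypothesis system : geometric_blocking_system P ell x pi_ alpha G w.

Let denom_neq0 (i k : nat) : (1 <= i)%N -> 1 + alpha k * x i != 0.
Proof. by move=> i0; rewrite gt_eqF //; have := alpha_x _ k i0; lra. Qed.

Lemma at_rows_le (n : nat) (mu lam : nat -> nat) (t : T) :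
  at_rows ell G n lam t -> at_rows ell G 0 mu t -> forall r : 'I_ell, (mu r <= lam r)%N.
Proof.
move=> hl hm r; rewrite -hm -hl; elim: n {hl} => // n IH; apply: leq_trans IH _.
by apply: (positions_le _ _ _ _ _ _ _ system); rewrite /= ltn_ord.
Qed.

Lemma growth_sum0 (mu lam : nat -> nat) :
  (forall r, (r < ell)%N -> (mu r <= lam r <= N)%N) -> (0 < M)%N ->
  @growth_sum R ell N M alpha beta x 0 mu lam = [forall r : 'I_ell, mu r == lam r]%:R.
Proof.
move=> mlN M0; rewrite /growth_sum; case: (boolP [forall r, _]) => [/forallP ml|].
  rewrite (big_pred1 [ffun b : 'I_ell * 'I_N => if (b.2 < mu b.1)%N then ord0 else
    ord_max]).
    by rewrite big1 // => b _; rewrite big_geq.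
  move=> K; apply/forallP/eqP => [gK|-> b].
    apply/ffunP => b; rewrite ffunE; have := gK b; rewrite -(eqP (ml b.1)).
    by case: (b.2 < mu b.1)%N => /eqP kb; exact/val_inj.
  by rewrite ffunE -(eqP (ml b.1)); case: (b.2 < mu b.1)%N => /=.
rewrite negb_forall => /existsP[r mr].
rewrite big_pred0 // => K; apply/negP => /forallP gK.
have /andP[ml lN] := mlN r (ltn_ord r).
have lt : (mu r < lam r)%N by rewrite ltn_neqAle mr.
have cN : (mu r < N)%N by exact: leq_trans lt lN.
have := gK (r, Ordinal cN); rewrite /= ltnn lt => /andP[k0].
by rewrite leqn0 => /eqP k00; rewrite k00 in k0.
Qed.

Lemma growth_probability (n : nat) (mu lam : nat -> nat) : (n < M)%N ->
  (forall r, lam r.+1 <= lam r)%N -> (forall r, lam r <= N)%N ->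
  (forall r, mu r <= lam r)%N ->
  (forall r, (ell <= r)%N -> lam r = 0%N) ->
  pr P (at_rows ell G n lam `&` at_rows ell G 0 mu) =
  (\prod_(1 <= i < n.+1) (1 - pi_ 1%N * x i)) *
  (row_power (ell := ell) pi_ alpha mu lam *
   @growth_sum R ell N M alpha beta x n mu lam) * pr P (at_rows ell G 0 mu).
Proof.
elim: n lam => [|n IH] lam nM lam_dec lam_N mu_lam lam_out.
  rewrite big_geq // mul1r growth_sum0 //; last first.
    by move=> r _; rewrite mu_lam lam_N.
  case: (boolP [forall r, _]) => [/forallP ml|nml].
    rewrite mulr1 /row_power big1 ?mul1r; last by move=> r _;
      rewrite (eqP (ml r)) big_geq.
    congr (pr P _); apply/seteqP; split => [t []//|t h]; split => // r.
    by rewrite h (eqP (ml r)).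
  rewrite mulr0 mul0r (_ : _ `&` _ = set0) ?pr0 //.
  apply/seteqP; split => // t [h1 h2]; move/negP: nml; apply; apply/forallP => r.
  by rewrite -h1 -h2.
rewrite (chapman_kolmogorov P ell x pi_ alpha G w pi_x alpha_x alpha_pi alpha0 system
  N) //.
rewrite growth_sum_rec // !mulr_sumr mulr_suml [RHS]big_mkcond /=.
apply: eq_bigr => kap _; case: ifP => [/forallP mk|/negbT]; last first.
  rewrite negb_forall => /existsP[r mr].
  rewrite (_ : _ `&` _ = set0) ?pr0 ?mul0r //.
  apply/seteqP; split => // t [h1 h2]; move/negP: mr; apply.
  by have := at_rows_le n _ _ t h1 h2 r; rewrite config_row_in.
rewrite (transition_step x pi_ alpha beta) //; last by move=> k; exact: denom_neq0.
(* The intermediate kap ranges over all functions, while the induction hypothesis needs a decreasing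
   one. A nonzero step makes kap and lam interlace, which gives kap_(r+1) <= lam_(r+1) <= kap_r. *)
have [->|st] := eqVneq (step (ell := ell) alpha beta x (config_row kap) lam n.+1) 0.
  by rewrite !mulr0 mul0r.
have int := step_neq0_interlace _ _ _ _ _ _ st.
have mu_out r : (ell <= r)%N -> mu r = 0%N.
  by move=> rl; have := mu_lam r; rewrite lam_out // leqn0 => /eqP.
have mk' r : (mu r <= config_row kap r)%N.
  case: (ltnP r ell) => rl; last by rewrite mu_out.
  by have := mk (Ordinal rl); rewrite -config_row_in.
rewrite IH //; first last.
- by move=> r rl; rewrite config_row_out.
- exact: config_row_le.
- move=> r; case: (ltnP r.+1 ell) => rl; last by rewrite config_row_out.
  have /andP[h1 _] := int _ rl; have /andP[_ h2] := int _ (ltnW rl).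
  exact: leq_trans h1 h2.
- exact: ltnW.
rewrite [\prod_(1 <= i < n.+2) _]big_nat_recr //=.
rewrite -(row_power_trans (ell := ell) pi_ alpha mu (config_row kap) lam); last first.
  by move=> r rl; rewrite mk'; have /andP[] := int r rl.
ring.
Qed.

End growth_probability.

(** * The transition probabilities *)

Lemma partition_dec (s : seq nat) (r : nat) :
  is_partition s -> (part s r.+2 <= part s r.+1)%N.
Proof.
move=> /andP[ss _]; rewrite /part /=; case: (ltnP r.+1 (size s)) => rs; last first.
  by rewrite nth_default.
have geq_tr : transitive geq by move=> a b c /= ab bc; exact: leq_trans bc ab.
exact: (sorted_ltn_nth geq_tr 0%N ss r r.+1 (ltnW rs) rs (ltnSn r)).
Qed.

Lemma partition_le_head (s : seq nat) (r : nat) :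
  is_partition s -> (part s r.+1 <= part s 1)%N.
Proof. by move=> ps; elim: r => // r; apply: leq_trans; exact: partition_dec. Qed.

Lemma part_out (s : seq nat) (r : nat) : (size s <= r)%N -> part s r.+1 = 0%N.
Proof. by move=> sr; rewrite /part /= nth_default. Qed.

Lemma rational_value_G_dslash {R : realType} {ell N M n : nat}
    (alpha beta x : nat -> R) (lam mu : seq nat) :
  is_partition mu -> (size lam <= ell)%N -> (size mu <= ell)%N -> (n < M)%N ->
  (forall r, part lam r.+1 <= N)%N -> subshape mu lam ->
  (forall c i, (0 < i <= n)%N -> 1 + alpha c.+1 * x i != 0) ->
  rational_value (G_dslash alpha beta lam mu) (fun i : 'I_n => x i.+1)
    (@growth_sum R ell N M alpha beta x n
      (fun r => part mu r.+1) (fun r => part lam r.+1)).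
Proof.
move=> mu_part lam_ell mu_ell nM lam_N mu_lam denom_neq0.
have mu_lam' r : (part mu r.+1 <= part lam r.+1)%N by exact: mu_lam.
have mu_dec r := partition_dec mu r mu_part.
rewrite /growth_sum -sum_corners //; last first.
  by move=> r; exact: leq_trans (mu_lam' r) (lam_N r).
rewrite (_ : G_dslash alpha beta lam mu = fun m =>
    \sum_(S : {set 'I_(size mu)} | corner_rows S)
      (\prod_(b <- boxes mu (remove_corners S)) - (alpha b.2 + beta b.1)) *
      G_skew alpha beta lam (remove_corners S) m); last first.
  by apply/funext => m; rewrite /G_dslash asboolT.
apply: rational_value_sum => S cS.
have rm_le r : (part (remove_corners S) r.+1 <= part mu r.+1)%N.
  by rewrite part_remove_corners leq_subr.
rewrite -(sum_letters (M := M) alpha beta x) //.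
- apply: rational_value_G_skew => b i.
  have /andP[_ /andP[c0 _]] := box_bounds b.
  by rewrite -(prednK (leq_ltn_trans (leq0n _) c0)); apply: denom_neq0;
    rewrite /= ltn_ord.
- by move=> r; exact: leq_trans (rm_le r) (mu_lam' r).
- move=> r; apply: leq_trans (rm_le _) _; rewrite part_remove_corners.
  case: insubP => [r' _ rr'|_]; last by rewrite subn0.
  case: (boolP (r' \in S)) => rS; last by rewrite subn0.
  have := forall_inP cS r' rS; rewrite -rr' /=; lia.
Qed.

Theorem theorem8p2 (d : measure_display) (T : measurableType d) (R : realType)
    (P : probability T R) (ell : nat) (x pi_ alpha beta : nat -> R)
    (G w : nat -> nat -> T -> nat) (n : nat) (lam mu : seq nat)
    (lam_partition : is_partition lam) (lam_parts : (size lam <= ell)%N)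
    (mu_partition : is_partition mu) (mu_parts : (size mu <= ell)%N)
    (alpha0 : alpha 0%N = 0)
    (pi_out : forall j, (ell < j)%N -> pi_ j = 0)
    (pi_x : forall i j, (1 <= i)%N -> (1 <= j <= ell)%N ->
       0 < pi_ j * x i < 1)
    (alpha_x : forall i k, (1 <= i)%N -> -1 < alpha k * x i)
    (alpha_pi : forall j k, (1 <= j <= ell)%N -> 0 <= alpha k + pi_ j)
    (beta_pi : forall j, (1 <= j)%N -> beta j = pi_ j.+1)
    (system : geometric_blocking_system P ell x pi_ alpha G w)
    (mu_possible : (0 < P (at_config ell G 0 mu))%E) :
  exists2 g : R,
    rational_value (G_dslash alpha beta lam mu) (fun i : 'I_n => x i.+1) g &
    transition_prob P ell G n lam mu =
      (\prod_(1 <= i < n.+1) (1 - pi_ 1%N * x i)) *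
      alpha_pi_power alpha pi_ lam mu * g.
Proof.
have at_configE i (s : seq nat) :
    at_config ell G i s = at_rows ell G i (fun r => part s r.+1).
  apply/seteqP; split => [t h r|t h [//|j] /andP[_ jl]].
    by apply: h; rewrite /= ltn_ord.
  exact: (h (Ordinal jl)).
have mrows := measurable_at_rows P ell x pi_ alpha G w system.
have mu0 : pr P (at_rows ell G 0 (fun r => part mu r.+1)) != 0.
  by move: mu_possible; rewrite at_configE prE // lte_fin => /gt_eqF ->.
rewrite /transition_prob /cond_prob !at_configE -!/(pr P _).
have [sub|nsub] := pselect (subshape mu lam); last first.
  (* If mu is not contained in lam, the series is 0, and lam cannot be reached from mu because
     positions never decrease. *)
  exists 0.
    rewrite (_ : G_dslash alpha beta lam mu = fun=> 0); first exact: rational_value0.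
    by apply/funext => m; rewrite /G_dslash asboolF.
  rewrite mulr0 (_ : _ `&` _ = set0) ?pr0 ?mul0r //.
  apply/seteqP; split => // t [h1 h2]; apply: nsub => -[//|r] _.
  case: (ltnP r ell) => rl; last by rewrite part_out // (leq_trans mu_parts rl).
  exact: (at_rows_le _ _ _ _ _ _ _ system _ _ _ _ h1 h2 (Ordinal rl)).
(* The rectangle has as many columns as the first row of lam, and [n.+1] is the least letter that
   can mark empty boxes. *)
exists (@growth_sum R ell (part lam 1) n.+1 alpha beta x n
      (fun r => part mu r.+1) (fun r => part lam r.+1)).
  apply: rational_value_G_dslash => //; first by move=> r; exact: partition_le_head.
  move=> c i /andP[i0 _]; rewrite gt_eqF //.
  by have := alpha_x i c.+1 i0; lra.
rewrite (growth_probability P ell (part lam 1) n.+1 x pi_ alpha beta G w) //.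
- rewrite mulfK // mulrA; congr (_ * _ * _).
  rewrite /alpha_pi_power asboolT // (prod_boxes ell) //.
- by move=> r; exact: partition_dec.
- by move=> r; exact: partition_le_head.
- by move=> r; exact: sub.
- by move=> r rl; rewrite part_out // (leq_trans lam_parts rl).
Qed.
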